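(* Let $\Lambda$ be an artin algebra and let $\mathcal{T}$ be a homogeneous tube of the Auslander-Reiten quiver of $\Lambda$, with indecomposable modules $M[t]$, where $t\in\mathbb{N}_1=\{1,2,3,\dots\}$. Let $m\ge 2$. (a) In every Gabriel-Roiter filtration of $M[m]$ there occurs a submodule of $M[m]$ which is isomorphic to $M[1]$. (b) If $M[1]$ is a brick, then $M[m]$ has a unique Gabriel-Roiter submodule, namely the unique submodule of $M[m]$ which is isomorphic to $M[m-1]$.
   Context: All modules are $\Lambda$-modules of finite length, and $|M|$ denotes the length of $M$. The Gabriel-Roiter measure $\mu(M)$ is the rational number defined inductively by: $\mu(0)=0$; if $M\neq 0$ is decomposable, $\mu(M)=\max\mu(M')$ over proper submodules $M'$ of $M$; if $M$ is indecomposable, $\mu(M)=2^{-|M|}+\max_{M'\subset M}\mu(M')$, the maximum being over proper submodules $M'$ of $M$. For $Y$ indecomposable and not simple, a Gabriel-Roiter submodule of $Y$ is an indecomposable proper submodule $X\subset Y$ with $\mu(Y)-\mu(X)=2^{-|Y|}$; the inclusion $X\subset Y$ is then a Gabriel-Roiter inclusion. A Gabriel-Roiter filtration of an indecomposable module $M$ is a chain of indecomposable submodules $M_1\subset M_2\subset\cdots\subset M_t=M$ with $M_1$ simple and all inclusions $M_{i-1}\subset M_i$ ($2\le i\le t$) Gabriel-Roiter inclusions. A component of the Auslander-Reiten quiver is a homogeneous tube if it is of the form $\mathbb{Z}A_\infty/\tau$, where $\tau$ is the Auslander-Reiten translation. The indecomposable modules belonging to a homogeneous tube $\mathcal{T}$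 are (up to isomorphism) labeled $M[t]$, $t\in\mathbb{N}_1$, such that $M[1]$ is of smallest possible length in $\mathcal{T}$ and $M[t]$ has a filtration with $t$ factors all isomorphic to $M[1]$ (so $|M[t]|=t|M[1]|$). A brick is a module whose endomorphism ring is a division ring. *)

(* Defs.v *)
(* MathComp, with the classical layer (boolp, classical_sets) of MathComp-Analysis. *)
From HB Require Import structures.
From Stdlib Require Export Relation_Operators.
From mathcomp Require Export all_boot all_order all_algebra.
From mathcomp Require Export boolp classical_sets.

Set Implicit Arguments.
Unset Strict Implicit.
Unset Printing Implicit Defensive.

Import Order.TTheory GRing.Theory Num.Theory.

Local Open Scope ring_scope.

(** * Submodules *)

(* A submodule of [M] is a term of the library type [submodClosed M], a
   predicate on [M]; submodules are compared as sets, by [{subset U <= V}] and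
   [U =i V]. [submod U] is the submodule [U] regarded as a module. *)

Section Submodules.
Variables (A : pzRingType) (M : lmodType A).

Definition zero_pred : {pred M} := pred1 0.
Fact zero_pred_closed : subsemimod_closed zero_pred.
Proof.
split=> [|a x]; last by rewrite !inE => /eqP->; rewrite scaler0.
by split=> [|x y]; rewrite !inE // => /eqP-> /eqP->; rewrite addr0.
Qed.
HB.instance Definition _ :=
  GRing.isSubmodClosed.Build A M zero_pred zero_pred_closed.

Definition full_pred : {pred M} := predT.
Fact full_pred_closed : subsemimod_closed full_pred.
Proof. by []. Qed.
HB.instance Definition _ :=
  GRing.isSubmodClosed.Build A M full_pred full_pred_closed.

Definition zero_submod : submodClosed M := zero_pred.
Definition full_submod : submodClosed M := full_pred.

Definition submod (U : submodClosed M) : Type := {x : M | x \in U}.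
HB.instance Definition _ (U : submodClosed M) := SubChoice.on (submod U).
HB.instance Definition _ (U : submodClosed M) :=
  [SubChoice_isSubLmodule of submod U by <:].

Definition proper_submod (U V : submodClosed M) : Prop :=
  {subset U <= V} /\ ~ {subset V <= U}.

Definition maximal_in (U V : submodClosed M) : Prop :=
  proper_submod U V /\
  forall W : submodClosed M, ~ (proper_submod U W /\ proper_submod W V).

Definition composition_series (n : nat) (U : nat -> submodClosed M) : Prop :=
  [/\ U 0%N =i zero_submod, U n =i full_submod &
      forall i, (i < n)%N -> maximal_in (U i) (U i.+1)].

End Submodules.


(** * Modules of finite length *)

Section Modules.
Variable A : pzRingType.
Implicit Types M N W X Y Z E C D : lmodType A.

Definition isom M N : Prop := exists f : {linear M -> N}, bijective f.

Definition zero_module M : Prop := forall x : M, x = 0.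

Definition simple_module M : Prop :=
  ~ zero_module M /\
  forall U : submodClosed M, U =i zero_submod M \/ U =i full_submod M.

Definition indecomposable M : Prop :=
  ~ zero_module M /\
  forall U V : submodClosed M,
    (forall x : M, exists u v : M, [/\ u \in U, v \in V & x = u + v]) ->
    (forall x : M, x \in U -> x \in V -> x = 0) ->
    U =i zero_submod M \/ V =i zero_submod M.

Definition finite_length M : Prop := exists n U, @composition_series A M n U.

(* By Jordan-Hoelder the choice of the composition series is immaterial;
   the value is 0 if there is none. *)
Definition mod_length M : nat :=
  xget 0%N [set n | exists U, @composition_series A M n U]%classic.

(* The endomorphism ring of [M] is nonzero and its nonzero elements are
   invertible. *)
Definition brick M : Prop :=
  ~ zero_module M /\
  forall f : {linear M -> M}, (exists x, f x <> 0) ->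
    exists g : {linear M -> M}, cancel f g /\ cancel g f.

(* For [U] contained in [V]: the quotient [V / U] is isomorphic to [N]. *)
Definition quotient_isom M (U V : submodClosed M) N : Prop :=
  exists f : {linear submod V -> N},
    (forall y : N, exists x, f x = y) /\
    (forall x : submod V, f x = 0 <-> val x \in U).

(* [M] has a filtration with [t] factors, all isomorphic to [N]. *)
Definition filtered_by M N (t : nat) : Prop :=
  exists F : nat -> submodClosed M,
    [/\ F 0%N =i zero_submod M, F t =i full_submod M &
        forall i, (i < t)%N ->
          {subset F i <= F i.+1} /\ quotient_isom (F i) (F i.+1) N].

(** * The Gabriel-Roiter measure *)

(* The largest element of [S] (0 if there is none). *)
Definition rat_max (S : set rat) : rat :=
  xget 0 [set q | S q /\ forall r, S r -> r <= q]%classic.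

(* Recursion on a bound [n] for the length: a module of length at most [n] is
   zero or has only proper submodules of length less than [n]. *)
Fixpoint gr_measure_rec (n : nat) M : rat :=
  if n is n'.+1 then
    let best := rat_max
      [set gr_measure_rec n' (submod U) |
         U in [set U : submodClosed M | proper_submod U (full_submod M)]]%classic in
    if `[< zero_module M >] then 0
    else if `[< indecomposable M >] then 2^-1 ^+ mod_length M + best
    else best
  else 0.

Definition gr_measure M : rat := gr_measure_rec (mod_length M) M.

(* [X] is a Gabriel-Roiter submodule of [Y], where [X] and [Y] are submodules
   of an ambient module [M]. *)
Definition gr_submodule M (X Y : submodClosed M) : Prop :=
  [/\ indecomposable (submod Y), ~ simple_module (submod Y),
      indecomposable (submod X), proper_submod X Y &
      gr_measure (submod Y) - gr_measure (submod X) = 2^-1 ^+ mod_length (submod Y)].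

(* [F 1], ..., [F t] is a Gabriel-Roiter filtration of [M]; [F 0] and [F i]
   for [i > t] are irrelevant. *)
Definition gr_filtration M (t : nat) (F : nat -> submodClosed M) : Prop :=
  [/\ (1 <= t)%N,
      forall i, (1 <= i <= t)%N -> indecomposable (submod (F i)),
      simple_module (submod (F 1%N)),
      F t =i full_submod M &
      forall i, (2 <= i <= t)%N -> gr_submodule (F i.-1) (F i)].

(** * The Auslander-Reiten quiver *)

Definition split_mono X Y (f : {linear X -> Y}) : Prop :=
  exists g : {linear Y -> X}, cancel f g.

Definition split_epi X Y (f : {linear X -> Y}) : Prop :=
  exists g : {linear Y -> X}, cancel g f.

Definition irreducible_map X Y (f : {linear X -> Y}) : Prop :=
  [/\ ~ split_mono f, ~ split_epi f &
      forall W (h : {linear X -> W}) (g : {linear W -> Y}), finite_length W ->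
        (forall x, f x = g (h x)) -> split_mono h \/ split_epi g].

Definition right_almost_split E Z (g : {linear E -> Z}) : Prop :=
  ~ split_epi g /\
  forall W (h : {linear W -> Z}), finite_length W -> ~ split_epi h ->
    exists h' : {linear W -> E}, forall w, h w = g (h' w).

Definition left_almost_split X E (f : {linear X -> E}) : Prop :=
  ~ split_mono f /\
  forall W (h : {linear X -> W}), finite_length W -> ~ split_mono h ->
    exists h' : {linear E -> W}, forall x, h x = h' (f x).

Definition right_minimal E Z (g : {linear E -> Z}) : Prop :=
  forall e : {linear E -> E}, (forall x, g (e x) = g x) -> bijective e.

Definition left_minimal X E (f : {linear X -> E}) : Prop :=
  forall e : {linear E -> E}, (forall x, e (f x) = f x) -> bijective e.

(* 0 -> X -f-> E -g-> Z -> 0 is an almost split sequence. *)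
Definition almost_split_sequence X E Z
    (f : {linear X -> E}) (g : {linear E -> Z}) : Prop :=
  [/\ injective f, (forall z, exists y, g y = z),
      (forall y, g y = 0 <-> exists x, f x = y),
      left_almost_split f & right_almost_split g].

(* [X] is the Auslander-Reiten translate of the indecomposable module [Z]:
   the starting term of the almost split sequence ending in [Z]. *)
Definition ar_translate Z X : Prop :=
  exists E (f : {linear X -> E}) (g : {linear E -> Z}),
    finite_length E /\ almost_split_sequence f g.

(* The vertices are the isomorphism classes of such modules. *)
Definition ar_vertex X : Prop := finite_length X /\ indecomposable X.

Definition ar_arrow X Y : Prop :=
  [/\ ar_vertex X, ar_vertex Y &
      exists f : {linear X -> Y}, irreducible_map f].

Definition is_summand X C : Prop := exists f : {linear X -> C}, split_mono f.

(* The module X^a + C. *)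
Definition pow_sum X (a : nat) C : lmodType A := ({ffun 'I_a -> X} * C)%type.

(* The arrow [X] -> [Y] has valuation (a, b): there are a minimal right almost
   split map X^a + C -> Y and a minimal left almost split map X -> Y^b + D,
   where X is not a summand of C and Y is not a summand of D. *)
Definition ar_valuation X Y (a b : nat) : Prop :=
  (exists C (g : {linear pow_sum X a C -> Y}),
     [/\ finite_length C, ~ is_summand X C,
         right_almost_split g & right_minimal g]) /\
  (exists D (f : {linear X -> pow_sum Y b D}),
     [/\ finite_length D, ~ is_summand Y D,
         left_almost_split f & left_minimal f]).

Definition ar_adjacent X Y : Prop :=
  [/\ ar_vertex X, ar_vertex Y & isom X Y \/ ar_arrow X Y].

(* A class of modules is identified with the set of isomorphism classes of its
   members. *)
Definition ar_component (T : lmodType A -> Prop) : Prop :=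
  exists X, ar_vertex X /\
    forall Y, T Y <-> ar_vertex Y /\
      clos_refl_sym_trans (lmodType A) ar_adjacent X Y.

(** * Homogeneous tubes *)

(* The translation quiver Z A_infinity, with A_infinity oriented as
   0 -> 1 -> 2 -> ... *)
Definition zainf_arrow (x y : int * nat) : Prop :=
  (y.1 = x.1 /\ y.2 = x.2.+1) \/ (y.1 = x.1 + 1 /\ x.2 = y.2.+1).

Definition zainf_tau (x : int * nat) : int * nat := (x.1 - 1, x.2).

Definition zainf_orbit (x y : int * nat) : Prop :=
  exists n, y = iter n zainf_tau x \/ x = iter n zainf_tau y.

(* [V] induces an isomorphism of valued translation quivers from
   Z A_infinity / tau onto [T]; all arrows have the trivial valuation. *)
Definition homogeneous_tube (T : lmodType A -> Prop) : Prop :=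
  ar_component T /\
  exists V : int * nat -> lmodType A,
    (forall x, T (V x)) /\
    (forall X, T X -> exists x, isom X (V x)) /\
    (forall x y, isom (V x) (V y) <-> zainf_orbit x y) /\
    (forall x y, ar_arrow (V x) (V y) <->
       exists2 y', zainf_orbit y y' & zainf_arrow x y') /\
    (forall x y, ar_arrow (V x) (V y) -> ar_valuation (V x) (V y) 1 1) /\
    (forall x, ar_translate (V x) (V (zainf_tau x))).

(* The modules in the tube [T] are, up to isomorphism, [M 1], [M 2], ...;
   the value [M 0] is irrelevant. *)
Definition tube_labelling (T : lmodType A -> Prop) (M : nat -> lmodType A)
    : Prop :=
  [/\ forall t, (1 <= t)%N -> T (M t),
      forall X, T X -> exists2 t, (1 <= t)%N & isom X (M t),
      forall s t, (1 <= s)%N -> (1 <= t)%N -> isom (M s) (M t) -> s = t,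
      forall X, T X -> (mod_length (M 1%N) <= mod_length X)%N &
      forall t, (1 <= t)%N -> filtered_by (M t) (M 1%N) t].

End Modules.

(** * Artin algebras *)

Definition artinian (k : comNzRingType) : Prop :=
  forall I : nat -> submodClosed k^o,
    (forall n, {subset I n.+1 <= I n}) ->
    exists N, forall n, (N <= n)%N -> I n =i I N.

Definition artin_algebra (k : comNzRingType) (A : algType k) : Prop :=
  artinian k /\
  exists (n : nat) (e : 'I_n -> A),
    forall a : A, exists c : 'I_n -> k, a = \sum_i c i *: e i.

(* Main.v *)
From HB Require Import structures.
Require Import Defs.
From mathcomp Require Import lra zify.

(** The Auslander-Reiten sequences of the tube provide maps
    p_t : M[t+1] -> M[t], with kernel isomorphic to M[1], along which every map
    N -> M[t] lifts, as soon as N has no split epimorphism onto a module of the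
    tube.

    (a) If N is contained in M[m] and |N| <= |M[1]|, but N is not isomorphic to
    M[1], then lifting the images of N in M[m-1], M[m-2], ... shows that N is
    cogenerated by M[1], so mu(N) < mu(M[1]) by the main property of the measure
    when N is indecomposable. As M[1] embeds into M[m], a Gabriel-Roiter
    filtration of M[m] has to reach M[1] when its length reaches |M[1]|.

    (b) If M[1] is a brick, then every nonzero map M[1] -> M[m] has the kernel
    of p_(m-1) as image. So the Gabriel-Roiter submodules X of M[m] contain this
    kernel by (a). Let K be the largest member of the uniserial filtration
    0 < M[1] < M[2] < ... of M[m] contained in X. There are no nonzero maps
    M[1] -> X/K, so X/K lifts along the maps p_t to a complement of K in X, and
    X = K. *)

Set Implicit Arguments.
Unset Strict Implicit.
Unset Printing Implicit Defensive.

Import Order.TTheory GRing.Theory Num.Theory.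

Local Open Scope ring_scope.

(** * Linear maps and submodules *)

Section LinearMaps.
Variable A : pzRingType.
Implicit Types M N K : lmodType A.

(** The almost split sequences at different modules of the tube come with unrelated maps, and the
    lifting property needs them to match: the map p_n : M[n+1] -> M[n] in the second map of the
    sequence at M[n] must also be a component of the first map of the sequence at M[n+1]. Since an
    irreducible map M[n+1] -> M[n] is such a component up to an automorphism of the middle term, the
    p_n can be chosen one after another. Exactness then reads p a = - d p, and surjectivity, lifts
    and kernels all follow from this relation. The middle terms M[n+2] + M[n] are deduced from
    arrows and valuations by cancelling indecomposable summands. A zero module placed below M[1]
    makes the mouth of the tube look like the other levels. Measures are compared through one
    numerical fact: on modules of length at most n the values are multiples of 2^-n, so distinct
    values differ by at least 2^-n. In (b), the claim on maps M[1] -> M[m] is the delicate one: a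
    map not killed by p is pushed through a mesh to a map into a shorter module of the tube, where
    induction applies. *)

Definition lin_of M N (f : M -> N) (H : linear f) : {linear M -> N} :=
  HB.pack f (GRing.isLinear.Build A M N _ f H).

Lemma inj_surj_bij M N (f : M -> N) :
  injective f -> (forall y, exists x, f x = y) -> bijective f.
Proof.
move=> fI fS; pose g y := proj1_sig (cid (fS y)).
have gK : cancel g f by move=> y; rewrite /g; case: cid.
by exists g => // x; apply: fI; rewrite gK.
Qed.

Lemma bij_surj M N (f : M -> N) : bijective f -> forall y, exists x, f x = y.
Proof. by case=> g _ gK y; exists (g y). Qed.

Lemma bij_inverse M N (f : {linear M -> N}) :
  bijective f -> exists g : {linear N -> M}, cancel f g /\ cancel g f.
Proof.
case=> g fK gK; have gl : linear g by apply: (can2_linear fK gK).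
by exists (lin_of gl).
Qed.

Lemma inj_lin M N (f : {linear M -> N}) :
  (forall x, f x = 0 -> x = 0) -> injective f.
Proof.
move=> f0 x y fxy; apply/eqP; rewrite -subr_eq0; apply/eqP/f0.
by rewrite linearB /= fxy subrr.
Qed.

Lemma isom_refl M : isom M M.
Proof. by exists idfun; exists idfun. Qed.

Lemma isom_sym M N : isom M N -> isom N M.
Proof. by case=> f /bij_inverse[g [fK gK]]; exists g; exists f. Qed.

Lemma isom_trans M N K : isom M N -> isom N K -> isom M K.
Proof.
case=> f bf [g bg]; exists (g \o f : {linear M -> K}).
exact: (bij_comp bg bf).
Qed.

Lemma isom_zero M N : isom M N -> zero_module M -> zero_module N.
Proof.
by case=> f [g _ gK] M0 x; rewrite -(gK x) (M0 (g x)) linear0.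
Qed.

(** Function extensionality and irrelevance of the closure proofs. Leibniz equality is wanted
    because submodules occur inside the dependent type [submod U], where only rewriting is
    convenient. *)
Lemma submod_ext M (U V : submodClosed M) : U =i V -> U = V.
Proof.
case: U V => [u [[a1] [a2]]] [v [[b1] [b2]]] /= uv.
have e : u = v by apply/funext => x; exact: uv.
subst v.
by rewrite (Prop_irrelevance a1 b1) (Prop_irrelevance a2 b2).
Qed.

Definition sub_of M (P : M -> Prop) : {pred M} := fun x => `[< P x >].

Fact sub_of_closed M (P : M -> Prop) (P0 : P 0)
    (PL : forall a x y, P x -> P y -> P (a *: x + y)) :
  subsemimod_closed (sub_of P).
Proof.
split=> [|a x /asboolP Px]; last first.
  by apply/asboolP; rewrite -[a *: x]addr0; apply: PL.
split; first exact/asboolP.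
move=> x y /asboolP Px /asboolP Py; apply/asboolP.
by rewrite -[x]scale1r; apply: PL.
Qed.

Definition mksub M (P : M -> Prop) (P0 : P 0)
    (PL : forall a x y, P x -> P y -> P (a *: x + y)) : submodClosed M :=
  HB.pack (sub_of P) (GRing.isSubmodClosed.Build A M _ (sub_of_closed P0 PL)).

Lemma mksubP M (P : M -> Prop) P0 PL x : reflect (P x) (x \in @mksub M P P0 PL).
Proof. exact: asboolP. Qed.

End LinearMaps.

Section Lattice.
Variable A : pzRingType.
Implicit Types M N K : lmodType A.

Lemma in_zero_submod M (x : M) : (x \in zero_submod M) = (x == 0).
Proof. by []. Qed.

Lemma in_full_submod M (x : M) : x \in full_submod M.
Proof. by []. Qed.

Lemma sub_scaleD M (U : submodClosed M) a x y :
  x \in U -> y \in U -> a *: x + y \in U.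
Proof. by move=> xU yU; rewrite rpredD ?rpredZ. Qed.

Lemma sub_B M (U : submodClosed M) (x y : M) : x \in U -> y \in U -> x - y \in U.
Proof. by move=> xU yU; rewrite addrC -scaleN1r; apply: sub_scaleD. Qed.

Fact imsub0 M N (f : {linear M -> N}) (U : submodClosed M) :
  exists2 x, x \in U & f x = 0.
Proof. by exists 0; rewrite ?rpred0 ?linear0. Qed.

Fact imsubL M N (f : {linear M -> N}) (U : submodClosed M) a y z :
  (exists2 x, x \in U & f x = y) -> (exists2 x, x \in U & f x = z) ->
  exists2 x, x \in U & f x = a *: y + z.
Proof.
move=> [u uU <-] [v vU <-]; exists (a *: u + v); first exact: sub_scaleD.
by rewrite linearP.
Qed.

Definition imsub M N (f : {linear M -> N}) (U : submodClosed M) :=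
  mksub (imsub0 f U) (@imsubL _ _ f U).

Fact presub0 M N (f : {linear M -> N}) (V : submodClosed N) : f 0 \in V.
Proof. by rewrite linear0 rpred0. Qed.

Fact presubL M N (f : {linear M -> N}) (V : submodClosed N) a x y :
  f x \in V -> f y \in V -> f (a *: x + y) \in V.
Proof. by move=> xV yV; rewrite linearP sub_scaleD. Qed.

Definition presub M N (f : {linear M -> N}) (V : submodClosed N) :=
  mksub (presub0 f V) (@presubL _ _ f V).

Definition kersub M N (f : {linear M -> N}) := presub f (zero_submod N).

Fact capsub0 M (U V : submodClosed M) : 0 \in U /\ 0 \in V.
Proof. by rewrite !rpred0. Qed.

Fact capsubL M (U V : submodClosed M) a x y :
  x \in U /\ x \in V -> y \in U /\ y \in V ->
  a *: x + y \in U /\ a *: x + y \in V.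
Proof. by move=> [? ?] [? ?]; rewrite !sub_scaleD. Qed.

Definition capsub M (U V : submodClosed M) :=
  mksub (capsub0 U V) (@capsubL _ U V).

Fact sumsub0 M (U V : submodClosed M) :
  exists u v, [/\ u \in U, v \in V & 0 = u + v].
Proof. by exists 0, 0; rewrite !rpred0 addr0. Qed.

Fact sumsubL M (U V : submodClosed M) a (x y : M) :
  (exists u v, [/\ u \in U, v \in V & x = u + v]) ->
  (exists u v, [/\ u \in U, v \in V & y = u + v]) ->
  exists u v, [/\ u \in U, v \in V & a *: x + y = u + v].
Proof.
move=> [u [v [uU vV ->]]] [u' [v' [uU' vV' ->]]].
exists (a *: u + u'), (a *: v + v'); split; try exact: sub_scaleD.
by rewrite scalerDr addrACA.
Qed.

Definition sumsub M (U V : submodClosed M) :=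
  mksub (sumsub0 U V) (@sumsubL _ U V).

Lemma in_imsub M N (f : {linear M -> N}) (U : submodClosed M) y :
  reflect (exists2 x, x \in U & f x = y) (y \in imsub f U).
Proof. exact: mksubP. Qed.

Lemma imsub_f M N (f : {linear M -> N}) (U : submodClosed M) x :
  x \in U -> f x \in imsub f U.
Proof. by move=> xU; apply/in_imsub; exists x. Qed.

Lemma in_presub M N (f : {linear M -> N}) (V : submodClosed N) x :
  (x \in presub f V) = (f x \in V).
Proof. by apply/mksubP/idP. Qed.

Lemma in_kersub M N (f : {linear M -> N}) x : (x \in kersub f) = (f x == 0).
Proof. exact: in_presub. Qed.

Lemma in_capsub M (U V : submodClosed M) x :
  (x \in capsub U V) = (x \in U) && (x \in V).
Proof. by apply/mksubP/andP. Qed.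

Lemma in_sumsub M (U V : submodClosed M) x :
  reflect (exists u v, [/\ u \in U, v \in V & x = u + v]) (x \in sumsub U V).
Proof. exact: mksubP. Qed.

Lemma sumsub_l M (U V : submodClosed M) x : x \in U -> x \in sumsub U V.
Proof. by move=> xU; apply/in_sumsub; exists x, 0; rewrite rpred0 addr0. Qed.

Lemma sumsub_r M (U V : submodClosed M) x : x \in V -> x \in sumsub U V.
Proof. by move=> xV; apply/in_sumsub; exists 0, x; rewrite rpred0 add0r. Qed.

Lemma submod_anti M (U V : submodClosed M) :
  {subset U <= V} -> {subset V <= U} -> U = V.
Proof. by move=> UV VU; apply: submod_ext => x; apply/idP/idP; auto. Qed.

Lemma properP M (U V : submodClosed M) : proper_submod U V ->
  {subset U <= V} /\ exists2 x, x \in V & x \notin U.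
Proof.
move=> [UV VU]; split=> //; apply: contrapT => H; apply: VU => x xV.
by apply: contrapT => /negP xU; apply: H; exists x.
Qed.

Lemma proper_intro M (U V : submodClosed M) x :
  {subset U <= V} -> x \in V -> x \notin U -> proper_submod U V.
Proof. by move=> UV xV xU; split=> // /(_ x xV); exact/negP. Qed.

Lemma sub_full_eq M (U : submodClosed M) :
  {subset full_submod M <= U} -> U = full_submod M.
Proof. by move=> H; apply: submod_anti. Qed.

Lemma presub_im M N (f : {linear M -> N}) (U : submodClosed M) :
  injective f -> presub f (imsub f U) = U.
Proof.
move=> fI; apply: submod_anti => x; rewrite in_presub.
  by case/in_imsub => y yU /fI <-.
exact: imsub_f.
Qed.

Lemma imsub_full M N (f : {linear M -> N}) :
  imsub f (full_submod M) = full_submod N <-> forall y, exists x, f x = y.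
Proof.
split=> [e y|fS].
  have : y \in imsub f (full_submod M) by rewrite e.
  by case/in_imsub => x _; exists x.
apply: sub_full_eq => y _; have [x <-] := fS y; exact: imsub_f.
Qed.

Lemma im_val_full M (U : submodClosed M) :
  imsub (val : {linear submod U -> M}) (full_submod _) = U.
Proof.
apply: submod_anti => x.
  by case/in_imsub => y _ <-; exact: (valP y).
by move=> xU; apply/in_imsub; exists (Sub x xU : submod U).
Qed.

(** * Length *)

(** Length of a submodule measured inside the fixed ambient module and peeled from the top, so that
    inductions along a series never change the carrier type. *)
Fixpoint clen M n (V : submodClosed M) : Prop :=
  if n is n'.+1 then exists W, maximal_in W V /\ clen n' W
  else V = zero_submod M.

(** The second isomorphism theorem in lattice form: a submodule [W] strictly between the
    intersection and [N] would give [W + K] strictly between [K] and [V], by the modular law. *)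
Lemma maximal_cap M (K V N : submodClosed M) :
  maximal_in K V -> {subset N <= V} -> ~ {subset N <= K} ->
  maximal_in (capsub N K) N.
Proof.
move=> [[KV VK] Kmax] NV NK; split.
  split=> [x|H]; first by rewrite in_capsub => /andP[].
  by apply: NK => x /H; rewrite in_capsub => /andP[].
move=> W [[CW WC] [WN NW]]; apply: (Kmax (sumsub W K)); split.
  split; first exact: sumsub_r.
  move=> H; apply: WC => w wW; rewrite in_capsub WN //=.
  by apply: H; apply: sumsub_l.
split=> [x /in_sumsub[w [k [wW kK ->]]]|H].
  by apply: rpredD; [apply/NV/WN|apply: KV].
apply: NW => x xN; have /H/in_sumsub[w [k [wW kK e]]] := NV x xN.
have kN : k \in N.
  have -> : k = x - w by rewrite e [w + k]addrC addrK.
  by apply: sub_B => //; apply: WN.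
by rewrite e; apply: rpredD => //; apply: CW; rewrite in_capsub kN.
Qed.

Lemma clen_proper M n (V N : submodClosed M) :
  clen n V -> proper_submod N V -> exists2 k, (k < n)%N & clen k N.
Proof.
elim: n V N => [|n IH] V N /=.
  by move=> -> [_ []] x; rewrite in_zero_submod => /eqP->; exact: rpred0.
case=> K [KV Kn] [NV VN].
case: (pselect {subset N <= K}) => [NK|NK].
  case: (pselect {subset K <= N}) => [KN|KN].
    by exists n => //; rewrite (submod_anti NK KN).
  have [k kn kN] := IH _ _ Kn (conj NK KN : proper_submod N K).
  by exists k => //; exact: ltnW.
(* Here [N] is not inside [K]. If [K] were inside [N], then [N] would lie strictly between [K] and
   [V], against maximality; so induction applies to the intersection, and [N] is one step above
   it. *)
have cK : proper_submod (capsub N K) K.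
  split=> [x|H]; first by rewrite in_capsub => /andP[].
  apply: (KV.2 N); split=> //; split=> // x /H.
  by rewrite in_capsub => /andP[].
have [k kn kC] := IH _ _ Kn cK.
exists k.+1 => //=; exists (capsub N K); split=> //.
exact: maximal_cap KV NV NK.
Qed.

(** Jordan-Hoelder for lengths only: the first term below [W] in one series is a proper submodule,
    hence shorter with respect to the other series, and by induction its length does not depend on
    the series. *)
Lemma clen_uniq M n n' (V : submodClosed M) : clen n V -> clen n' V -> n = n'.
Proof.
have [m le_nm] := ubnP n; elim: m => // m IH in n n' V le_nm *.
have half : forall a b W, (a <= m)%N -> @clen M a W -> clen b W -> (b <= a)%N.
  move=> a [//|b] W le_am aW [K [[KW _] Kb]].
  have [k ka kK] := clen_proper aW KW.
  by rewrite -(IH k b K _ kK Kb) //; exact: leq_trans ka le_am.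
move=> nV n'V; have le1 := half n n' V le_nm nV n'V.
apply/eqP; rewrite eqn_leq le1 andbT; apply: half n'V nV.
exact: leq_trans le1 le_nm.
Qed.

Lemma maximal_presub M N (f : {linear M -> N}) (W V : submodClosed N) :
  {subset V <= imsub f (full_submod M)} -> maximal_in W V ->
  maximal_in (presub f W) (presub f V).
Proof.
move=> Vf [WV Wmax]; have [sWV [v vV vW]] := properP WV; split.
  have /in_imsub[x _ fx] := Vf v vV.
  apply: (@proper_intro _ _ _ x); rewrite ?in_presub ?fx // => y.
  by rewrite !in_presub; apply: sWV.
move=> X [/properP[WX [x xX xW]] /properP[XV [y yV yX]]].
(* [X] contains the kernel of [f], being above a preimage; so it is saturated and can be compared
   with its image. *)
have Xf z : f z \in imsub f X -> z \in X.
  case/in_imsub => z' z'X e; rewrite -(subrK z' z) rpredD //.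
  by apply: WX; rewrite in_presub linearB /= e subrr rpred0.
apply: (Wmax (imsub f X)); split.
  apply: (@proper_intro _ _ _ (f x)).
  - move=> w wW; have /in_imsub[z _ fz] := Vf w (sWV w wW).
    by rewrite -fz; apply: imsub_f; apply: WX; rewrite in_presub fz.
  - exact: imsub_f.
  - by rewrite -in_presub.
apply: (@proper_intro _ _ _ (f y)).
- by move=> w /in_imsub[z /XV]; rewrite in_presub => ? <-.
- by rewrite -in_presub.
- by apply/negP => /Xf; exact/negP.
Qed.

Lemma maximal_imsub M N (f : {linear M -> N}) (W U : submodClosed M) :
  maximal_in W U -> imsub f W = imsub f U \/ maximal_in (imsub f W) (imsub f U).
Proof.
move=> [/properP[WU _] Wmax].
have sWU : {subset imsub f W <= imsub f U}.
  by move=> y /in_imsub[x /WU xU <-]; exact: imsub_f.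
case: (pselect {subset imsub f U <= imsub f W}) => H.
  by left; apply: submod_anti.
right; split=> // X [/properP[WX [x xX xW]] /properP[XU [y yU yX]]].
apply: (Wmax (capsub (presub f X) U)); split.
  have /in_imsub[u uU fu] := XU x xX.
  apply: (@proper_intro _ _ _ u).
  - by move=> w wW; rewrite in_capsub in_presub WU // andbT WX // imsub_f.
  - by rewrite in_capsub in_presub fu xX.
  - by apply: contra xW => uW; rewrite -fu imsub_f.
have /in_imsub[u uU fu] := yU.
apply: (@proper_intro _ _ _ u) => //.
  by move=> w; rewrite in_capsub => /andP[].
by rewrite in_capsub in_presub fu (negbTE yX).
Qed.

(** Additivity of length: the preimages of a series of [V] are stacked on top of a series of the
    kernel. *)
Lemma clen_presub M N (f : {linear M -> N}) a b (V : submodClosed N) :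
  {subset V <= imsub f (full_submod M)} ->
  clen a (kersub f) -> clen b V -> clen (a + b) (presub f V).
Proof.
move=> Vf fa; elim: b V Vf => [|b IH] V Vf /=; first by move=> ->; rewrite addn0.
move=> [W [WV Wb]]; rewrite addnS; exists (presub f W); split.
  exact: maximal_presub.
by apply: IH => // x xW; apply: Vf; case: (properP WV.1) => H _; exact: H.
Qed.

Lemma clen_imsub M N (f : {linear M -> N}) n (U : submodClosed M) :
  clen n U -> exists2 k, (k <= n)%N & clen k (imsub f U).
Proof.
elim: n U => [|n IH] U /=.
  move=> ->; exists 0%N => //=; apply: submod_anti => x.
    by case/in_imsub => y; rewrite !in_zero_submod => /eqP-> <-; rewrite linear0.
  by rewrite in_zero_submod => /eqP->; exact: rpred0.
case=> W [WU /IH[k kn kW]]; case: (maximal_imsub f WU) => [<-|mx].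
  by exists k => //; exact: leqW.
by exists k.+1 => //=; exists (imsub f W).
Qed.

Lemma kersub_inj M N (f : {linear M -> N}) : injective f ->
  kersub f = zero_submod M.
Proof.
move=> fI; apply: submod_ext => x; rewrite in_kersub in_zero_submod.
by apply/eqP/eqP => [fx|->]; [apply: fI; rewrite fx linear0|exact: linear0].
Qed.

Lemma clen_composition M n : clen n (full_submod M) <->
  exists U, @composition_series A M n U.
Proof.
suff H (V : submodClosed M) : clen n V <-> exists U : nat -> submodClosed M,
    [/\ U 0%N = zero_submod M, U n = V &
        forall i, (i < n)%N -> maximal_in (U i) (U i.+1)].
  rewrite H; split=> [[U [U0 Un Umax]]|[U [U0 Un Umax]]]; exists U; split=> //.
  - by move=> x; rewrite U0.
  - by move=> x; rewrite Un.
  - exact: submod_ext.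
  - exact: submod_ext.
elim: n V => [|n IH] V /=.
  split=> [->|[U [U0 U0' _]]]; last by rewrite -U0'.
  by exists (fun=> zero_submod M); split.
split=> [[W [WV /IH[U [U0 Un Umax]]]]|[U [U0 Un Umax]]].
  exists (fun i => if (i <= n)%N then U i else V); split=> //.
    by rewrite ltnn.
  move=> i lin; have [<-|ne] := eqVneq n i; first by rewrite leqnn ltnn Un.
  have {ne}lin : (i < n)%N by lia.
  by rewrite /= (ltnW lin) lin; apply: Umax.
exists (U n); split; first by rewrite -Un; apply: Umax.
by apply/IH; exists U; split=> // i lin; apply: Umax; exact: ltnW.
Qed.

Definition has_length M n := clen n (full_submod M).

Lemma has_lengthE M n : has_length M n -> finite_length M /\ mod_length M = n.
Proof.
move=> nM; have [U cU] := (clen_composition M n).1 nM.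
split; first by exists n, U.
rewrite /mod_length; case: xgetP => [m _ [V cV]|/(_ n) []]; last by exists U.
by apply: (clen_uniq _ nM); apply/clen_composition; exists V.
Qed.

Lemma finite_has_length M : finite_length M -> has_length M (mod_length M).
Proof.
move=> [n [U cU]]; have nM : has_length M n by apply/clen_composition; exists U.
by have [_ ->] := has_lengthE nM.
Qed.

Lemma nonzero_exists M : ~ zero_module M -> exists x : M, x <> 0.
Proof.
move=> M0; apply: contrapT => H; apply: M0 => x; apply: contrapT => x0.
by apply: H; exists x.
Qed.

Lemma mod_length0 M : finite_length M -> mod_length M = 0%N <-> zero_module M.
Proof.
move=> fM; have := finite_has_length fM; split=> [e|M0].
  move: H; rewrite e => H x; apply/eqP.
  by rewrite -in_zero_submod -H.
suff /has_lengthE[] : has_length M 0 by [].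
by rewrite /has_length /=; apply: submod_ext => x; rewrite in_zero_submod (M0 x) eqxx.
Qed.

Lemma zero_finite M : zero_module M -> finite_length M.
Proof.
move=> M0; suff /has_lengthE[] : has_length M 0 by [].
by rewrite /has_length /=; apply: submod_ext => x; rewrite in_zero_submod (M0 x) eqxx.
Qed.

Lemma inj_length M N (f : {linear M -> N}) : injective f -> finite_length N ->
  [/\ finite_length M, (mod_length M <= mod_length N)%N &
      mod_length M = mod_length N -> bijective f].
Proof.
move=> fI /finite_has_length nN.
have im k : clen k (imsub f (full_submod M)) -> has_length M k.
  move=> kf; rewrite /has_length -(presub_im (full_submod M) fI).
  rewrite -(add0n k); apply: clen_presub => //=.
  exact: kersub_inj.
case: (pselect {subset full_submod N <= imsub f (full_submod M)}) => [H|H].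
  have e := sub_full_eq H; have /im/has_lengthE[fM ->] :
    clen (mod_length N) (imsub f (full_submod M)) by rewrite e.
  split=> // _; apply: inj_surj_bij => // y.
  by have /in_imsub[x _ <-] := H y isT; exists x.
have [k kn /im/has_lengthE[fM ->]] := clen_proper nN (conj (fun _ _ => isT) H).
split=> //; first exact: ltnW.
by move=> e; rewrite e ltnn in kn.
Qed.

Lemma surj_finite M N (f : {linear M -> N}) :
  (forall y, exists x, f x = y) -> finite_length M -> finite_length N.
Proof.
move=> /imsub_full fS /finite_has_length nM.
have [k _] := clen_imsub f nM; rewrite fS.
by case/has_lengthE.
Qed.

Lemma submod_val_inj M (U : submodClosed M) :
  injective (val : {linear submod U -> M}).
Proof. exact: val_inj. Qed.

Lemma submod_finite M (U : submodClosed M) :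
  finite_length M -> finite_length (submod U).
Proof. by move=> fM; case: (inj_length (@submod_val_inj _ U) fM). Qed.

Lemma submod_length M (U : submodClosed M) :
  finite_length M -> (mod_length (submod U) <= mod_length M)%N.
Proof. by move=> fM; case: (inj_length (@submod_val_inj _ U) fM). Qed.

Lemma proper_length M (U : submodClosed M) : finite_length M ->
  proper_submod U (full_submod M) -> (mod_length (submod U) < mod_length M)%N.
Proof.
move=> fM [_ H]; have [_ le bij] := inj_length (@submod_val_inj _ U) fM.
rewrite ltn_neqAle le andbT; apply/eqP => /bij/bij_surj vS.
by apply: H => x _; have [y <-] := vS x; exact: (valP y).
Qed.

Lemma exact_length (X E Z : lmodType A) (f : {linear X -> E}) (g : {linear E -> Z}) :
  injective f -> (forall z, exists y, g y = z) ->
  (forall y, g y = 0 <-> exists x, f x = y) ->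
  finite_length X -> finite_length Z ->
  finite_length E /\ mod_length E = (mod_length X + mod_length Z)%N.
Proof.
move=> fI gS ex /finite_has_length nX /finite_has_length nZ.
apply: has_lengthE; rewrite /has_length.
have -> : full_submod E = presub g (full_submod Z).
  by apply: submod_ext => x; rewrite in_presub.
apply: clen_presub nZ; first by move=> z _; have [y <-] := gS z; exact: imsub_f.
have ek : kersub g = imsub f (full_submod X).
  apply: submod_ext => y; rewrite in_kersub; apply/eqP/in_imsub => [/ex[x <-]|[x _ <-]].
    by exists x.
  by apply/ex; exists x.
have [k _ kf] := clen_imsub f nX.
rewrite ek; have kX : has_length X k.
  rewrite /has_length -(presub_im (full_submod X) fI).
  rewrite -(add0n k); apply: clen_presub => //=.
  exact: kersub_inj.
by rewrite (clen_uniq nX kX).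
Qed.

Lemma bij_length M N (f : {linear M -> N}) : bijective f -> finite_length N ->
  finite_length M /\ mod_length M = mod_length N.
Proof.
move=> bf fN; have [fM le _] := inj_length (bij_inj bf) fN; split=> //.
apply/eqP; rewrite eqn_leq le /=.
have [g [fK gK]] := bij_inverse bf.
by have [_] := inj_length (can_inj gK) fM.
Qed.

Lemma isom_length M N : isom M N -> finite_length N ->
  finite_length M /\ mod_length M = mod_length N.
Proof. by case=> f; exact: bij_length. Qed.

Lemma ker_length M N (f : {linear M -> N}) :
  (forall y, exists x, f x = y) -> finite_length M ->
  mod_length M = (mod_length (submod (kersub f)) + mod_length N)%N.
Proof.
move=> fS fM; have fN := surj_finite fS fM; have fK := submod_finite (kersub f) fM.
have [||_ //] := @exact_length _ _ _ (val : {linear submod (kersub f) -> M}) f _ fS _ fK fN.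
  exact: submod_val_inj.
move=> y; split=> [fy|[x <-]].
  have yk : y \in kersub f by rewrite in_kersub fy.
  by exists (Sub y yk : submod (kersub f)).
by have := valP x; rewrite in_kersub => /eqP.
Qed.

Lemma surj_length M N (f : {linear M -> N}) :
  (forall y, exists x, f x = y) -> finite_length M ->
  (mod_length N <= mod_length M)%N /\
  (mod_length M = mod_length N -> bijective f).
Proof.
move=> fS fM; have e := ker_length fS fM; split; first by rewrite e leq_addl.
move=> eMN; apply: inj_surj_bij => //.
apply: inj_lin => x fx; have fK := submod_finite (kersub f) fM.
have /(mod_length0 fK) K0 : mod_length (submod (kersub f)) = 0%N by lia.
have xk : x \in kersub f by rewrite in_kersub fx.
by have := K0 (Sub x xk); move/(congr1 val).
Qed.

Lemma endo_inj_bij M (f : {linear M -> M}) :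
  finite_length M -> injective f -> bijective f.
Proof. by move=> fM fI; have [_ _] := inj_length fI fM; apply. Qed.

Lemma endo_surj_bij M (f : {linear M -> M}) :
  finite_length M -> (forall y, exists x, f x = y) -> bijective f.
Proof. by move=> fM fS; have [_] := surj_length fS fM; apply. Qed.

Lemma prod_length M N : finite_length M -> finite_length N ->
  finite_length (M * N)%type /\
  mod_length (M * N)%type = (mod_length M + mod_length N)%N.
Proof.
move=> fM fN; have inl_lin : linear (fun x : M => (x, 0) : M * N).
  by move=> a x y; apply: injective_projections; rewrite /= ?scaler0 ?addr0.
apply: (@exact_length _ _ _ (lin_of inl_lin) (snd : {linear (M * N)%type -> N})) => //.
- by move=> x y [].
- by move=> z; exists (0, z).
- move=> [x y] /=; split=> [->|[z [_ <-]] //]; by exists x.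
Qed.

End Lattice.

(** * Direct sum decompositions *)

Section Summands.
Variable A : pzRingType.
Implicit Types M N K X Y Z C D E W : lmodType A.

Definition linl M N : {linear M -> (M * N)%type} :=
  lin_of (f := fun x : M => (x, 0) : M * N) (fun a x y =>
    injective_projections (a *: x + y, 0) (a *: (x, 0) + (y, 0))
      (erefl _) (esym (etrans (addr0 _) (scaler0 _ _)))).

Definition linr M N : {linear N -> (M * N)%type} :=
  lin_of (f := fun y : N => (0, y) : M * N) (fun a x y =>
    injective_projections (0, a *: x + y) (a *: (0, x) + (0, y))
      (esym (etrans (addr0 _) (scaler0 _ _))) (erefl _)).

Fact copair_linear M N K (f : {linear M -> K}) (g : {linear N -> K}) :
  linear (fun z : M * N => f z.1 + g z.2).
Proof. by move=> a x y; rewrite /= !linearP /= scalerDr addrACA. Qed.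

Definition copair M N K (f : {linear M -> K}) (g : {linear N -> K}) :
  {linear (M * N)%type -> K} := lin_of (copair_linear f g).

Fact pairing_linear M N K (f : {linear K -> M}) (g : {linear K -> N}) :
  linear (fun z : K => (f z, g z) : M * N).
Proof. by move=> a x y; apply: injective_projections; exact: linearP. Qed.

Definition pairing M N K (f : {linear K -> M}) (g : {linear K -> N}) :
  {linear K -> (M * N)%type} := lin_of (pairing_linear f g).

Lemma copairE M N K (g : {linear (M * N)%type -> K}) x y :
  g (x, y) = g (linl M N x) + g (linr M N y).
Proof.
by rewrite -linearD; congr (g _); apply: injective_projections;
  rewrite /= ?addr0 ?add0r.
Qed.

Lemma val_scaleD M (U : submodClosed M) a (x y : submod U) :
  val (a *: x + y) = a *: val x + val y.
Proof. exact: (linearP (val : {linear submod U -> M})). Qed.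

Lemma incl_exists M (U V : submodClosed M) : {subset U <= V} ->
  exists i : {linear submod U -> submod V}, forall x, val (i x) = val x.
Proof.
move=> UV; pose i (x : submod U) : submod V := Sub (val x) (UV _ (valP x)).
have il : linear i by move=> a x y; apply: val_inj; rewrite val_scaleD.
by exists (lin_of il).
Qed.

Lemma subset_length M (U V : submodClosed M) : finite_length M ->
  {subset U <= V} -> (mod_length (submod U) <= mod_length (submod V))%N /\
  (mod_length (submod U) = mod_length (submod V) -> U = V).
Proof.
move=> fM UV; have [i iE] := incl_exists UV.
have iI : injective i by move=> x y e; apply: val_inj; rewrite -!iE e.
have [_ le bi] := inj_length iI (submod_finite V fM); split=> // /bi/bij_surj iS.
apply: submod_anti => // x xV; have [y] := iS (Sub x xV).
by move/(congr1 val); rewrite iE /= => <-; exact: (valP y).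
Qed.

Lemma corestrict M N (f : {linear N -> M}) (U : submodClosed M) :
  (forall x, f x \in U) ->
  exists g : {linear N -> submod U}, forall x, val (g x) = f x.
Proof.
move=> fU; pose g x : submod U := Sub (f x) (fU x).
have gl : linear g.
  by move=> a x y; apply: val_inj; rewrite val_scaleD; exact: linearP.
by exists (lin_of gl).
Qed.

Lemma isom_imsub M N (f : {linear M -> N}) (U : submodClosed M) :
  injective f -> isom (submod U) (submod (imsub f U)).
Proof.
move=> fI; have fU (x : submod U) : (f \o val) x \in imsub f U.
  exact/imsub_f/(valP x).
have [g gE] := corestrict fU; exists g; apply: inj_surj_bij.
  by move=> x y /(congr1 val); rewrite !gE => /fI/val_inj.
move=> y; have /in_imsub[x xU fx] := valP y.
by exists (Sub x xU); apply: val_inj; rewrite gE.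
Qed.

Lemma isom_full M : isom (submod (full_submod M)) M.
Proof.
exists (val : {linear submod (full_submod M) -> M}).
apply: inj_surj_bij; first exact: val_inj.
by move=> y; exists (Sub y isT : submod (full_submod M)).
Qed.

Lemma isom_im_full M N (f : {linear M -> N}) :
  injective f -> isom M (submod (imsub f (full_submod M))).
Proof.
by move=> fI; apply: isom_trans (isom_imsub _ fI); apply/isom_sym/isom_full.
Qed.

Lemma zero_submodP M (U : submodClosed M) :
  zero_module (submod U) <-> U = zero_submod M.
Proof.
split=> [U0|-> x].
  apply: submod_anti => x; last by rewrite in_zero_submod => /eqP->; exact: rpred0.
  by move=> xU; have /(congr1 val)/= := U0 (Sub x xU); rewrite in_zero_submod => ->.
by apply: val_inj => /=; apply/eqP; rewrite -in_zero_submod; exact: (valP x).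
Qed.

Lemma projections M (U V : submodClosed M) :
  (forall x : M, exists u v : M, [/\ u \in U, v \in V & x = u + v]) ->
  (forall x : M, x \in U -> x \in V -> x = 0) ->
  exists (p : {linear M -> submod U}) (q : {linear M -> submod V}),
    [/\ forall x, x = val (p x) + val (q x), cancel val p & cancel val q].
Proof.
move=> sUV cUV.
have H x : exists w : submod U * submod V, x = val w.1 + val w.2.
  have [u [v [uU vV ->]]] := sUV x.
  by exists (Sub u uU, Sub v vV).
pose w x := proj1_sig (cid (H x)).
have wE x : x = val (w x).1 + val (w x).2 by rewrite /w; case: cid.
have uniq (u u' : submod U) (v v' : submod V) :
    val u + val v = val u' + val v' -> u = u' /\ v = v'.
  move=> e; have e' : val u - val u' = val v' - val v.
    by apply/eqP; rewrite subr_eq addrAC eq_sym subr_eq e addrC.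
  have d0 : val u - val u' = 0.
    by apply: cUV; [|rewrite e']; apply: sub_B; exact: valP.
  split; apply/val_inj/eqP; rewrite -subr_eq0; first by rewrite d0.
  by rewrite -opprB -e' d0 oppr0.
have wL a x y : w (a *: x + y) = (a *: (w x).1 + (w y).1, a *: (w x).2 + (w y).2).
  have [] := uniq (w (a *: x + y)).1 (a *: (w x).1 + (w y).1)
    (w (a *: x + y)).2 (a *: (w x).2 + (w y).2).
    by rewrite -wE !val_scaleD addrACA -scalerDr -!wE.
  by move=> e1 e2; rewrite -e1 -e2; case: (w _).
have pl : linear (fun x => (w x).1) by move=> a x y; rewrite wL.
have ql : linear (fun x => (w x).2) by move=> a x y; rewrite wL.
exists (lin_of pl), (lin_of ql); split=> [x|x|x] /=; first exact: wE.
- by apply: (uniq _ _ (w (val x)).2 0 _).1; rewrite -wE /= addr0.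
- by apply: (uniq (w (val x)).1 0 _ _ _).2; rewrite -wE /= add0r.
Qed.

(** [M] is the direct sum of the image of [s] and the kernel of [r]; the image is nonzero, so the
    kernel vanishes. *)
Lemma indec_summand X M (s : {linear X -> M}) (r : {linear M -> X}) :
  indecomposable M -> ~ zero_module X -> cancel s r -> cancel r s.
Proof.
move=> [_ indM] X0 sK x.
have [|y|/(_ _)e|/(_ _) e] := indM (imsub s (full_submod X)) (kersub r).
- move=> y; exists (s (r y)), (y - s (r y)); split; first exact: imsub_f.
    by rewrite in_kersub linearB /= sK subrr.
  by rewrite addrC subrK.
- by case/in_imsub => z _ <-; rewrite in_kersub sK => /eqP->; rewrite linear0.
- case: X0 => y; rewrite -(sK y).
  have := e (s y); rewrite imsub_f // in_zero_submod => /esym/eqP->.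
  exact: linear0.
- have := e (x - s (r x)); rewrite in_kersub in_zero_submod linearB /= sK subrr eqxx.
  by move=> /esym; rewrite subr_eq0 => /eqP.
Qed.

Lemma indec_isom M N : isom M N -> indecomposable M -> indecomposable N.
Proof.
move=> iMN [M0 indM]; split=> [N0|U V sUV cUV].
  by apply: M0; exact: isom_zero (isom_sym iMN) N0.
case: iMN => f bf; have [g [fK gK]] := bij_inverse bf.
have z (U' : submodClosed N) : presub f U' =i zero_submod M -> U' =i zero_submod N.
  move=> e y; rewrite -(gK y) -in_presub e !in_zero_submod gK.
  by apply/eqP/eqP => [e0|->]; [rewrite -(gK y) e0|]; rewrite linear0.
have [x|x|/z|/z] := indM (presub f U) (presub f V); [| |by left|by right].
  have [u [v [uU vV e]]] := sUV (f x); exists (g u), (g v).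
  by rewrite !in_presub !gK -linearD -e fK.
by rewrite !in_presub => xU xV; apply: (bij_inj bf); rewrite linear0; apply: cUV.
Qed.

Lemma decompose M : ~ zero_module M -> ~ indecomposable M ->
  exists U V : submodClosed M, exists (p : {linear M -> submod U})
    (q : {linear M -> submod V}),
  [/\ proper_submod U (full_submod M), proper_submod V (full_submod M),
      forall x, x = val (p x) + val (q x) & cancel val p /\ cancel val q].
Proof.
move=> M0 dM; apply: contrapT => H; apply: dM; split=> // U V sUV cUV.
apply: contrapT => /not_orP[U0 V0]; apply: H.
have [p [q [pq pK qK]]] := projections sUV cUV.
have pr (U' V' : submodClosed M) (c : forall x, x \in U' -> x \in V' -> x = 0) :
    ~ V' =i zero_submod M -> proper_submod U' (full_submod M).
  move=> V'0; split=> // f; apply: V'0 => x; rewrite in_zero_submod.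
  apply/idP/eqP => [xV|->]; last exact: rpred0.
  by apply: c => //; apply: f.
exists U, V, p, q; split=> //; first exact: pr cUV V0.
by apply: pr U0 => x xV xU; apply: cUV.
Qed.

(** Takes the place of a complete decomposition into indecomposables: whenever the module splits,
    one of the two components of [z] is nonzero, and that summand is shorter. *)
Lemma exists_summand M z : finite_length M -> z <> 0 ->
  exists Z (s : {linear Z -> M}) (r : {linear M -> Z}),
    [/\ cancel s r, indecomposable Z & r z <> 0].
Proof.
have [n] := ubnP (mod_length M); elim: n M z => // n IH M z le fM z0.
case: (pselect (indecomposable M)) => [iM|dM].
  by exists M, idfun, idfun; split.
have M0 : ~ zero_module M by move=> /(_ z).
have [U [V [p [q [Up Vp e [pK qK]]]]]] := decompose M0 dM.
have aux (W : submodClosed M) (w : {linear M -> submod W}) :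
    proper_submod W (full_submod M) -> cancel val w -> w z <> 0 ->
    exists Z (s : {linear Z -> M}) (r : {linear M -> Z}),
      [/\ cancel s r, indecomposable Z & r z <> 0].
  move=> Wp wK wz; have lW := proper_length fM Wp.
  have [||Z [s [r [sK iZ rz]]]] := IH (submod W) (w z) _ _ wz.
  - exact: leq_trans lW le.
  - exact: submod_finite.
  exists Z, (val \o s : {linear Z -> M}), (r \o w : {linear M -> Z}).
  by split=> // x; rewrite /= wK sK.
case: (pselect (p z = 0)) => [pz|]; last exact: aux.
case: (pselect (q z = 0)) => [qz|]; last exact: aux.
by case: z0; rewrite (e z) pz qz /= addr0.
Qed.

(** * Fitting's lemma and cancellation *)

Fact iter_linear M (a : {linear M -> M}) k : linear (iter k a).
Proof. by elim: k => [|k IH] c x y //=; rewrite IH linearP. Qed.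

(** Locality of the endomorphism ring, by Fitting's lemma for [a]: for a high power [h] of [a], the
    module is the direct sum of the image and the kernel of [h]. If the kernel is zero, [a] is
    injective; if the image is zero, [b x = 0] gives [a x = x = h x = 0]. *)
Lemma indec_local M (a b : {linear M -> M}) :
  finite_length M -> indecomposable M -> (forall x, a x + b x = x) ->
  bijective a \/ bijective b.
Proof.
move=> fM iM ab; pose it k := lin_of (iter_linear a k.+1).
pose L k := mod_length (submod (kersub (it k))).
have exP : exists l, `[< exists k, L k = l >].
  by exists (L 0%N); apply/asboolP; exists 0%N.
have ubP l : `[< exists k, L k = l >] -> (l <= mod_length M)%N.
  by move/asboolP => [k <-]; exact: submod_length.
(* A power whose kernel has the largest length: from there on the kernels are stationary. The
   exponents are [k.+1], so [h] always kills the kernel of [a]. *)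
case: (ex_maxnP exP ubP) => l /asboolP[k kl] lmax.
have kmax j : (L j <= L k)%N by rewrite kl; apply: lmax; apply/asboolP; exists j.
pose h := it k; have hh x : h (h x) = it (k + k.+1)%N x.
  exact: (esym (iterD k.+1 k.+1 a x)).
have kk : kersub h = kersub (it (k + k.+1)%N).
  have sub : {subset kersub h <= kersub (it (k + k.+1)%N)}.
    by move=> x; rewrite !in_kersub -hh => /eqP->; rewrite linear0.
  have [le] := subset_length fM sub; apply.
  by apply/eqP; rewrite eqn_leq le; apply: kmax.
pose I := imsub h (full_submod M).
have hI (x : submod I) : (h \o val) x \in I by apply: imsub_f.
have [g gE] := corestrict hI.
have cIK x : x \in I -> x \in kersub h -> x = 0.
  case/in_imsub => y _ <-; rewrite in_kersub hh -in_kersub -kk in_kersub.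
  by move/eqP.
have gI : injective g.
  apply: inj_lin => x gx; apply: val_inj; apply: cIK; first exact: valP.
  by rewrite in_kersub -[h _]gE gx.
have /bij_surj gS := endo_inj_bij (submod_finite I fM) gI.
have [x|x|I0|K0] := iM.2 I (kersub h).
- have hx : h x \in I by exact: imsub_f.
  have [y gy] := gS (Sub (h x) hx); exists (val y), (x - val y).
  split; first exact: valP.
    rewrite in_kersub linearB subr_eq0; apply/eqP.
    by have := congr1 val gy; rewrite gE.
  by rewrite addrC subrK.
- exact: cIK.
- right; apply: endo_inj_bij => //; apply: inj_lin => x bx.
  have ax : a x = x by rewrite -[RHS]ab bx addr0.
  have itx j : iter j a x = x by elim: j => //= j ->.
  have hx : h x = x := itx k.+1.
  by apply/eqP; rewrite -in_zero_submod -I0 -hx imsub_f.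
- left; apply: endo_inj_bij => //; apply: inj_lin => x ax.
  apply/eqP; rewrite -in_zero_submod -K0 in_kersub -[h x]/(iter k.+1 a x).
  by rewrite iterSr ax; apply/eqP; exact: linear0 (lin_of (iter_linear a k)).
Qed.

(** Gaussian elimination on a 2 by 2 block matrix with invertible corner [a]: on the vectors
    [(- s c, c)], with [s] the inverse of [a] followed after [b], the first coordinate of [phi]
    vanishes, and the second is the Schur complement [t]. *)
Lemma cancel_unit X C C' (phi : {linear (X * C)%type -> (X * C')%type}) :
  bijective phi -> bijective (fun x => (phi (x, 0)).1) -> isom C C'.
Proof.
move=> bphi ba; have [psi [phiK psiK]] := bij_inverse bphi.
pose a : {linear X -> X} := fst \o phi \o linl X C.
have [a' [aK a'K]] := bij_inverse (ba : bijective a).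
pose b : {linear C -> X} := fst \o phi \o linr X C.
have phi1 x c : (phi (x, c)).1 = a x + b c by rewrite copairE.
pose s : {linear C -> X} := a' \o b.
pose t : {linear C -> C'} := snd \o phi \o pairing (\- s) idfun.
have s1 c : (phi (- s c, c)).1 = 0 by rewrite phi1 linearN a'K addNr.
have tE c : phi (- s c, c) = (0, t c).
  by apply: injective_projections; rewrite ?s1.
exists t; apply: inj_surj_bij.
  apply: inj_lin => c tc; have := tE c; rewrite tc => e.
  have : phi (- s c, c) = phi 0 by rewrite e linear0.
  by move/(can_inj phiK) => [].
move=> c'; case e : (psi (0, c')) => [x c]; exists c.
have pe : phi (x, c) = (0, c') by rewrite -e psiK.
have xs : x = - s c.
  have := congr1 fst pe; rewrite phi1 => /eqP; rewrite addr_eq0 => /eqP ea.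
  by rewrite -(aK x) ea linearN.
by have := tE c; rewrite -xs pe => -[].
Qed.

(** A local ring has stable range one. The corner of [phi] composed with its inverse reads
    [a a' + b c' = 1] on [X]. Either [a a'] is invertible, and so is [a]; or [b c'] is, and then a
    shear of the source makes the corner invertible. *)
Lemma cancel_isom X C C' : finite_length X -> indecomposable X ->
  isom (X * C)%type (X * C')%type -> isom C C'.
Proof.
move=> fX iX [phi bphi]; have [psi [phiK psiK]] := bij_inverse bphi.
pose a : {linear X -> X} := fst \o phi \o linl X C.
pose b : {linear C -> X} := fst \o phi \o linr X C.
pose a' : {linear X -> X} := fst \o psi \o linl X C'.
pose c' : {linear X -> C} := snd \o psi \o linl X C'.
have e x : (a \o a') x + (b \o c') x = x.
  rewrite /= -[LHS]/((phi (linl X C (psi (x, 0)).1) + phi (linr X C (psi (x, 0)).2)).1).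
  by rewrite -copairE -surjective_pairing psiK.
have [/bij_surj aS|bc] := indec_local fX iX e.
  apply: (cancel_unit bphi); apply: (@endo_surj_bij _ _ a) => // y.
  by have [x <-] := aS y; exists (a' x).
have [u [uK bcK]] := bij_inverse bc.
(* Chosen so that [b s = 1 - a]: after the shear the corner becomes [a + b s = 1]. *)
pose s : {linear X -> C} := c' \o u \o (idfun \- a).
pose sh : {linear (X * C)%type -> (X * C)%type} :=
  copair (pairing idfun s) (linr X C).
have shE x c : sh (x, c) = (x, s x + c).
  by apply: injective_projections; rewrite /= ?addr0.
have bsh : bijective sh.
  apply: inj_surj_bij.
    apply: inj_lin => -[x c]; rewrite shE => exc; have x0 : x = 0 := congr1 fst exc.
    by move: exc; rewrite x0 linear0 add0r.
  by move=> [x c]; exists (x, c - s x); rewrite shE addrC subrK.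
apply: (@cancel_unit _ _ _ (phi \o sh)); first exact: bij_comp.
apply: (@eq_bij _ _ idfun); first by exists id.
move=> x; rewrite -[RHS]/((phi (sh (x, 0))).1) shE addr0.
rewrite copairE -[RHS]/(a x + (b \o c') (u (x - a x))).
by rewrite bcK [RHS]addrC subrK.
Qed.

End Summands.

(** * Properties of the Gabriel-Roiter measure *)

Definition half n : rat := 2^-1 ^+ n.

Definition dyadic n (q : rat) : Prop := exists k : nat, q = k%:R * half n.

Lemma half_gt0 n : 0 < half n.
Proof. by rewrite /half exprn_gt0 // invr_gt0. Qed.

Lemma half_S n : half n = 2 * half n.+1.
Proof. by rewrite /half exprS mulrA divff ?mul1r. Qed.

Lemma half_le m n : (m <= n)%N -> half n <= half m.
Proof.
move=> /subnKC <-; elim: (n - m)%N => [|k IH]; first by rewrite addn0.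
rewrite addnS; apply: le_trans IH; rewrite [leRHS]half_S.
by have := half_gt0 (m + k).+1; lra.
Qed.

Lemma dyadic_le m n q : (m <= n)%N -> dyadic m q -> dyadic n q.
Proof.
move=> /subnKC <-; elim: (n - m)%N => [|k IH]; first by rewrite addn0.
move=> /IH[j ->]; exists (j * 2)%N; rewrite addnS natrM -mulrA.
by rewrite -half_S.
Qed.

Lemma dyadic_gap n q r : dyadic n q -> dyadic n r -> q < r ->
  q + half n <= r.
Proof.
move=> [j ->] [k ->]; have v0 := half_gt0 n.
rewrite ltr_pM2r // ltr_nat => jk.
rewrite -[X in _ + X]mul1r -mulrDl ler_pM2r //.
by rewrite -[1]/(1%:R) -natrD ler_nat addn1.
Qed.

(** The set may come from infinitely many submodules; its maximum exists because its members are
    multiples of [half n] below 1, so that the numerators are at most [2 ^ n]. *)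
Lemma rat_max_spec n (S : set rat) : (exists q, S q) ->
  (forall q, S q -> dyadic n q /\ q <= 1) ->
  S (rat_max S) /\ forall r, S r -> r <= rat_max S.
Proof.
move=> [q0 Sq0] Sd; pose P k := `[< S (k%:R * half n) >].
have exP : exists k, P k.
  by have [[k e] _] := Sd _ Sq0; exists k; apply/asboolP; rewrite -e.
have ubP k : P k -> (k <= 2 ^ n)%N.
  move=> /asboolP/Sd[_]; have v0 := half_gt0 n.
  by rewrite /half exprVn ler_pdivrMr ?mul1r -?natrX ?ler_nat // ltr0n expn_gt0.
case: (ex_maxnP exP ubP) => k /asboolP Sk kmax.
rewrite /rat_max; case: xgetP => [q _ [Sq qmax] //|/(_ (k%:R * half n)) []].
split=> // r Sr; have [[j e] _] := Sd _ Sr; rewrite e.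
rewrite ler_pM2r ?half_gt0 // ler_nat; apply: kmax.
by apply/asboolP; rewrite -e.
Qed.

Definition gr_best (A : pzRingType) (M : lmodType A) : rat := rat_max
  [set gr_measure (submod U) |
     U in [set U : submodClosed M | proper_submod U (full_submod M)]]%classic.

(* Reification by [lra] would try to evaluate the measures and the exponents. *)
Ltac lra_gr :=
  repeat match goal with
  | H : is_true ?P |- _ =>
      match P with
      | context [half _] => move: H
      | context [@gr_measure _ _] => move: H
      | context [@gr_best _ _] => move: H
      end
  | H : @eq rat _ _ |- _ => move: H
  end; clear;
  repeat match goal with
  | |- context [@gr_measure ?A ?M] => move: (@gr_measure A M) => ?
  | |- context [@gr_best ?A ?M] => move: (@gr_best A M) => ?
  | |- context [half ?n] => move: (half n) => ?
  end; lra.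

Section Measure.
Variable A : pzRingType.
Implicit Types M N X Y Z : lmodType A.

Lemma proper_imsub M N (f : {linear M -> N}) (U : submodClosed M) :
  injective f -> proper_submod U (full_submod M) ->
  proper_submod (imsub f U) (full_submod N).
Proof.
move=> fI /properP[_ [x _ xU]]; apply: (@proper_intro _ _ _ _ (f x)) => //.
by rewrite -in_presub presub_im.
Qed.

Lemma proper_not_surj M N (f : {linear M -> N}) :
  ~ (forall y, exists x, f x = y) ->
  proper_submod (imsub f (full_submod M)) (full_submod N).
Proof. by move=> fS; split=> // /sub_full_eq/imsub_full. Qed.

Lemma proper_val_not_surj M (U : submodClosed M) :
  proper_submod U (full_submod M) ->
  ~ (forall y, exists x : submod U, val x = y).
Proof. by move=> [_ H] vS; apply: H => y _; have [x <-] := vS y; exact: valP. Qed.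

Lemma gr_measure_rec_isom n M N : finite_length N -> isom M N ->
  gr_measure_rec n M = gr_measure_rec n N.
Proof.
elim: n M N => // n IH M N fN iMN /=.
have [fM ->] := isom_length iMN fN.
have -> : `[< zero_module M >] = `[< zero_module N >].
  by apply: asbool_equiv_eq; split; apply: isom_zero => //; exact: isom_sym.
have -> : `[< indecomposable M >] = `[< indecomposable N >].
  by apply: asbool_equiv_eq; split; apply: indec_isom => //; exact: isom_sym.
have sub M' N' : finite_length M' -> isom N' M' -> (
    [set gr_measure_rec n (submod U) |
       U in [set U : submodClosed N' | proper_submod U (full_submod N')]] `<=`
    [set gr_measure_rec n (submod U) |
       U in [set U : submodClosed M' | proper_submod U (full_submod M')]])%classic.
  move=> fM' [f bf] q [U Up <-]; exists (imsub f U).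
    exact: proper_imsub (bij_inj bf) Up.
  have i := isom_imsub U (bij_inj bf).
  by apply/esym/IH => //; exact: submod_finite.
suff -> : ([set gr_measure_rec n (submod U) |
       U in [set U : submodClosed M | proper_submod U (full_submod M)]] =
    [set gr_measure_rec n (submod U) |
       U in [set U : submodClosed N | proper_submod U (full_submod N)]])%classic.
  by [].
by apply/seteqP; split; apply: sub => //; exact: isom_sym.
Qed.

Lemma gr_isom M N : finite_length N -> isom M N -> gr_measure M = gr_measure N.
Proof.
move=> fN iMN; rewrite /gr_measure; have [_ ->] := isom_length iMN fN.
exact: gr_measure_rec_isom.
Qed.

(** The recursion bound is immaterial once it reaches the length. This is what turns the recursion
    into the inductive formula [gr_measureE]. *)
Lemma gr_measure_recE n M : finite_length M -> (mod_length M <= n)%N ->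
  gr_measure_rec n M = gr_measure M.
Proof.
have [m] := ubnP n; elim: m n M => // m IH [|n] M le fM Mn.
  by rewrite /gr_measure; move: Mn; rewrite leqn0 => /eqP->.
case: (pselect (zero_module M)) => M0.
  by rewrite /gr_measure ((mod_length0 fM).2 M0) /= asboolT.
rewrite /gr_measure; case e : (mod_length M) => [|l].
  by case: M0; apply/mod_length0.
rewrite /= e; suff -> : ([set gr_measure_rec n (submod U) |
       U in [set U : submodClosed M | proper_submod U (full_submod M)]] =
    [set gr_measure_rec l (submod U) |
       U in [set U : submodClosed M | proper_submod U (full_submod M)]])%classic by [].
apply: eq_imagel => U Up; have := proper_length fM Up; have fU := submod_finite U fM.
by move=> lU; rewrite !IH //; lia.
Qed.

Lemma gr_zero M : finite_length M -> zero_module M -> gr_measure M = 0.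
Proof. by move=> fM M0; rewrite /gr_measure ((mod_length0 fM).2 M0). Qed.

Lemma gr_measureE M : finite_length M -> ~ zero_module M ->
  gr_measure M =
    if `[< indecomposable M >] then half (mod_length M) + gr_best M
    else gr_best M.
Proof.
move=> fM M0; rewrite {1}/gr_measure; case e : (mod_length M) => [|l].
  by case: M0; apply/mod_length0.
rewrite /= e asboolF //.
suff -> : ([set gr_measure_rec l (submod U) |
       U in [set U : submodClosed M | proper_submod U (full_submod M)]] =
    [set gr_measure (submod U) |
       U in [set U : submodClosed M | proper_submod U (full_submod M)]])%classic by [].
apply: eq_imagel => U Up; have := proper_length fM Up; have fU := submod_finite U fM.
by move=> lU; rewrite gr_measure_recE //; lia.
Qed.

Lemma zero_proper M : ~ zero_module M ->
  proper_submod (zero_submod M) (full_submod M).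
Proof.
by move=> M0; split=> // H; apply: M0 => x; apply/eqP; rewrite -in_zero_submod H.
Qed.

(** The bound on the submodules is a hypothesis because [gr_dyadic] calls this lemma inside its own
    induction; [gr_best_spec] discharges it afterwards. *)
Lemma gr_best_dyadic M n : ~ zero_module M ->
  (forall U : submodClosed M, proper_submod U (full_submod M) ->
     dyadic n (gr_measure (submod U)) /\ gr_measure (submod U) <= 1) ->
  (exists2 U : submodClosed M, proper_submod U (full_submod M) &
     gr_measure (submod U) = gr_best M) /\
  forall U : submodClosed M, proper_submod U (full_submod M) ->
     gr_measure (submod U) <= gr_best M.
Proof.
move=> M0 H; have [||[U Up e] max] := @rat_max_spec n
    [set gr_measure (submod U) |
     U in [set U : submodClosed M | proper_submod U (full_submod M)]]%classic.
- by eexists; exists (zero_submod M) => //; exact: zero_proper.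
- by move=> q [U Up <-]; exact: H.
split; first by exists U.
by move=> V Vp; apply: max; exists V.
Qed.

(** The bound 1 is sharpened so that it survives the induction: a proper submodule has length at
    most [l] when the module has length [l.+1], and [1 - half l + half l.+1 = 1 - half l.+1]. *)
Lemma gr_dyadic M : finite_length M ->
  dyadic (mod_length M) (gr_measure M) /\
  gr_measure M <= 1 - half (mod_length M).
Proof.
have [n] := ubnP (mod_length M); elim: n M => // n IH M le fM.
case: (pselect (zero_module M)) => M0.
  rewrite gr_zero // ((mod_length0 fM).2 M0) [half 0]expr0 subrr.
  by split=> //; exists 0%N; rewrite mul0r.
case e : (mod_length M) => [|l]; first by case: M0; apply/mod_length0.
have H (U : submodClosed M) : proper_submod U (full_submod M) ->
    dyadic l (gr_measure (submod U)) /\ gr_measure (submod U) <= 1 - half l.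
  move=> Up; have lU := proper_length fM Up.
  have [|dU mU] := IH (submod U) _ (submod_finite U fM).
    exact: leq_trans lU le.
  have lUl : (mod_length (submod U) <= l)%N by lia.
  split; first exact: dyadic_le dU.
  by have := half_le lUl; lra_gr.
have [|[U Up eU] _] := @gr_best_dyadic M l M0.
  by move=> U /H[? ?]; split=> //; have := half_gt0 l; lra_gr.
have [dU mU] := H U Up; rewrite gr_measureE // -eU e.
have v1 := half_S l; have v0 := half_gt0 l.+1.
have d1 : dyadic l.+1 (gr_measure (submod U)) by exact: dyadic_le dU.
case: asboolP => _; split=> //; try lra_gr.
by have [k ->] := d1; exists k.+1; rewrite -natr1 mulrDl mul1r addrC.
Qed.

Lemma gr_ge0 M : finite_length M -> 0 <= gr_measure M.
Proof.
move=> /gr_dyadic[[k ->] _]; rewrite mulr_ge0 ?ler0n //.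
exact: ltW (half_gt0 _).
Qed.

Lemma gr_best_spec M : finite_length M -> ~ zero_module M ->
  (exists2 U : submodClosed M, proper_submod U (full_submod M) &
     gr_measure (submod U) = gr_best M) /\
  forall U : submodClosed M, proper_submod U (full_submod M) ->
     gr_measure (submod U) <= gr_best M.
Proof.
move=> fM M0; apply: (@gr_best_dyadic M (mod_length M)) => // U Up.
have [d m] := gr_dyadic (submod_finite U fM); split.
  by apply: dyadic_le d; exact: submod_length.
by have := half_gt0 (mod_length (submod U)); lra_gr.
Qed.

Lemma gr_indec M : finite_length M -> indecomposable M ->
  gr_measure M = half (mod_length M) + gr_best M.
Proof. by move=> fM iM; rewrite gr_measureE ?asboolT //; case: iM. Qed.

Lemma gr_lt_indec M N (f : {linear N -> M}) : injective f ->
  finite_length M -> indecomposable M -> ~ (forall y, exists x, f x = y) ->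
  gr_measure N + half (mod_length M) <= gr_measure M.
Proof.
move=> fI fM iM fS; have [_ H] := gr_best_spec fM iM.1.
have := H _ (proper_not_surj fS).
rewrite (gr_isom _ (isom_im_full fI)); last exact: submod_finite.
by rewrite (gr_indec fM iM); lra_gr.
Qed.

Lemma gr_le M N (f : {linear N -> M}) : injective f -> finite_length M ->
  gr_measure N <= gr_measure M.
Proof.
move=> fI fM; case: (pselect (forall y, exists x, f x = y)) => fS.
  by rewrite (gr_isom fM) //; exists f; exact: inj_surj_bij.
have M0 : ~ zero_module M.
  by move=> M0; apply: fS => y; exists 0; rewrite (M0 y) (M0 (f 0)).
have [_ H] := gr_best_spec fM M0; have := H _ (proper_not_surj fS).
rewrite (gr_isom _ (isom_im_full fI)); last exact: submod_finite.
rewrite [gr_measure M]gr_measureE //; case: asboolP => // _.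
by have := half_gt0 (mod_length M); lra_gr.
Qed.

Lemma gr_gt0 M : finite_length M -> ~ zero_module M -> 0 < gr_measure M.
Proof.
move=> fM M0.
have [x x0] := nonzero_exists M0.
have [Z [s [r [sK iZ _]]]] := exists_summand fM x0.
have [fZ _ _] := inj_length (can_inj sK) fM.
apply: lt_le_trans (gr_le (can_inj sK) fM); rewrite (gr_indec fZ iZ).
have [[U _ <-] _] := gr_best_spec fZ iZ.1.
by have := gr_ge0 (submod_finite U fZ); have := half_gt0 (mod_length Z); lra_gr.
Qed.

Lemma gr_indec_exists M : finite_length M -> ~ zero_module M ->
  exists X (f : {linear X -> M}),
    [/\ injective f, indecomposable X & gr_measure X = gr_measure M].
Proof.
have [n] := ubnP (mod_length M); elim: n M => // n IH M le fM M0.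
case: (pselect (indecomposable M)) => [iM|dM]; first by exists M, idfun; split.
have [[U Up eU] _] := gr_best_spec fM M0.
have eM : gr_measure M = gr_best M by rewrite gr_measureE // asboolF.
have fU := submod_finite U fM.
have U0 : ~ zero_module (submod U).
  by move=> /(gr_zero fU) e; have := gr_gt0 fM M0; rewrite eM -eU e ltxx.
have [|X [f [fI iX e]]] := IH (submod U) _ fU U0.
  exact: leq_trans (proper_length fM Up) le.
exists X, (val \o f : {linear X -> M}); split=> //.
  exact: inj_comp val_inj fI.
by rewrite e eU.
Qed.

Lemma not_simple_proper M : ~ zero_module M -> ~ simple_module M ->
  exists U : submodClosed M,
    proper_submod U (full_submod M) /\ ~ zero_module (submod U).
Proof.
move=> M0 nM; apply: contrapT => H; apply: nM; split=> // U.
case: (pselect (zero_module (submod U))) => [/zero_submodP->|U0]; first by left.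
right; case: (pselect (proper_submod U (full_submod M))) => [Up|nU].
  by case: H; exists U.
case: (pselect {subset full_submod M <= U}) => [/sub_full_eq-> //|s].
by case: nU.
Qed.

(** As [M] is not simple, it has a nonzero proper submodule, whose measure is positive; so the best
    proper submodule is nonzero and contains an indecomposable of the same measure. *)
Lemma gr_sub_exists M : finite_length M -> indecomposable M ->
  ~ simple_module M ->
  exists X (f : {linear X -> M}),
    [/\ injective f, ~ (forall y, exists x, f x = y), indecomposable X &
        gr_measure M = gr_measure X + half (mod_length M)].
Proof.
move=> fM iM nM; have [V [Vp V0]] := not_simple_proper iM.1 nM.
have [[U Up eU] H] := gr_best_spec fM iM.1; have fU := submod_finite U fM.
have U0 : ~ zero_module (submod U).
  move=> /(gr_zero fU) e; have := H V Vp; rewrite -eU e.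
  by have := gr_gt0 (submod_finite V fM) V0; lra_gr.
have [X [f [fI iX e]]] := gr_indec_exists fU U0.
exists X, (val \o f : {linear X -> M}); split=> //.
- exact: inj_comp val_inj fI.
- by move=> fS; apply: (proper_val_not_surj Up) => y; have [x <-] := fS y; exists (f x).
- by rewrite e eU gr_indec // addrC.
Qed.

Lemma simple_inj X Y (f : {linear X -> Y}) x :
  simple_module X -> f x <> 0 -> injective f.
Proof.
move=> [_ sX] fx; apply: inj_lin => z fz.
case: (sX (kersub f)) => H.
  by apply/eqP; rewrite -in_zero_submod -H in_kersub fz.
by case: fx; apply/eqP; rewrite -in_kersub H.
Qed.

(* Gabriel's main property of the measure; [S] is a family of maps which
   together embed [X] into a direct product. *)
Lemma gr_main_property X (c : rat) (S : forall Y, {linear X -> Y} -> Prop) :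
  finite_length X -> indecomposable X ->
  (forall Y f, S Y f ->
     [/\ finite_length Y, indecomposable Y & gr_measure Y <= c]) ->
  (forall x, x <> 0 -> exists Y (f : {linear X -> Y}), S Y f /\ f x <> 0) ->
  gr_measure X <= c /\
  (gr_measure X = c -> exists Y (f : {linear X -> Y}), S Y f /\ bijective f).
Proof.
have [n] := ubnP (mod_length X); elim: n X c S => // n IH X c S le fX iX HS sepS.
case: (pselect (exists Y (f : {linear X -> Y}), S Y f /\ injective f)).
  move=> [Y [f [Sf fI]]]; have [fY iY leY] := HS Y f Sf.
  have leX := gr_le fI fY; split=> [|eX]; first exact: le_trans leY.
  exists Y, f; split=> //; apply: inj_surj_bij => //; apply: contrapT => fS.
  have := gr_lt_indec fI fY iY fS; have := half_gt0 (mod_length Y).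
  by rewrite eX; lra_gr.
move=> noinj.
have [x0 x0_neq0] := nonzero_exists iX.1.
have nX : ~ simple_module X.
  move=> sX; have [Y [f [Sf fx]]] := sepS _ x0_neq0.
  by apply: noinj; exists Y, f; split=> //; exact: simple_inj sX fx.
have [X' [i [iI iS iX' eX]]] := gr_sub_exists fX iX nX.
have [fX' lX' bX'] := inj_length iI fX.
have ltX' : (mod_length X' < mod_length X)%N.
  rewrite ltn_neqAle lX' andbT; apply/eqP => /bX'/bij_surj; exact: iS.
(* No member of [S] being injective, their images are shorter than [X]. Indecomposable summands of
   these images still separate the elements of [X], and monotonicity keeps their measures at most
   [c]. *)
pose P Z (h : {linear X -> Z}) := [/\ finite_length Z, indecomposable Z,
  (mod_length Z < mod_length X)%N & gr_measure Z <= c].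
have sepP x : x <> 0 -> exists Z (h : {linear X -> Z}), P Z h /\ h x <> 0.
  move=> /sepS[Y [f [Sf fx]]]; have [fY iY leY] := HS Y f Sf.
  pose I := imsub f (full_submod X).
  have fI y : f y \in I by exact: imsub_f.
  have [g gE] := corestrict fI.
  have gS y : exists z, g z = y.
    have /in_imsub[z _ e] := valP y; exists z; apply: val_inj; by rewrite gE.
  have [leI bI] := surj_length gS fX.
  have ltI : (mod_length (submod I) < mod_length X)%N.
    rewrite ltn_neqAle leI andbT; apply/eqP => /esym/bI/bij_inj gI.
    by apply: noinj; exists Y, f; split=> // y z e; apply: gI; apply: val_inj; rewrite !gE.
  have gx : g x <> 0 by move=> /(congr1 val); rewrite gE.
  have fin := submod_finite I fY.
  have [Z [s [r [sK iZ rx]]]] := exists_summand fin gx.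
  have [fZ lZ _] := inj_length (can_inj sK) fin.
  exists Z, (r \o g : {linear X -> Z}); split=> //; split=> //.
    exact: leq_ltn_trans lZ ltI.
  apply: le_trans leY; apply: le_trans (gr_le (can_inj sK) fin) _.
  exact: gr_le (@submod_val_inj _ _ I) fY.
(* [X'] and [Z] have length at most [|X| - 1], so a strict inequality means a gap of at least
   [2 * half |X|], while [X] exceeds [X'] by [half |X|] only; hence [X] stays strictly below [Z],
   and so below [c]. *)
case: (pselect (exists Z (h : {linear X -> Z}), P Z h /\ gr_measure X' < gr_measure Z)).
  move=> [Z [h [[fZ iZ lZ leZ] ltZ]]].
  case e : (mod_length X) => [|l]; first by case: iX.1; apply/mod_length0.
  have [dX' _] := gr_dyadic fX'; have [dZ _] := gr_dyadic fZ.
  have d1 : dyadic l (gr_measure X') by apply: dyadic_le dX'; lia.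
  have d2 : dyadic l (gr_measure Z) by apply: dyadic_le dZ; lia.
  have := dyadic_gap d1 d2 ltZ.
  have := half_S l; have := half_gt0 l.+1; move: eX; rewrite e.
  by split; [|move=> ?; exfalso]; lra_gr.
(* Otherwise induction applies to [X'], with its own measure as bound and the maps restricted along
   [i]. The equality case makes some restriction bijective, so that [X'] would be a proper nonzero
   direct summand of [X]. *)
move=> allZ; exfalso.
pose S' Z (g : {linear X' -> Z}) :=
  exists h : {linear X -> Z}, P Z h /\ forall x, g x = h (i x).
have [|||_ /(_ erefl)] := IH X' (gr_measure X') S' _ fX' iX'.
- exact: leq_trans ltX' le.
- move=> Z g [h [Ph _]]; have [fZ iZ _ _] := Ph; split=> //.
  by rewrite leNgt; apply/negP => lt; apply: allZ; exists Z, h.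
- move=> x x_neq0; have ix : i x <> 0.
    by move=> ix; apply: x_neq0; apply: iI; rewrite ix linear0.
  have [Z [h [Ph hx]]] := sepP _ ix; exists Z, (h \o i : {linear X' -> Z}).
  by split=> //; exists h.
move=> [Z [g [[h [_ gh]] /bij_inverse[g' [gK _]]]]].
apply: iS => y; exists (g' (h y)).
apply: (@indec_summand _ X' X i (g' \o h)) => //; first exact: iX'.1.
by move=> x /=; rewrite -gh gK.
Qed.

End Measure.

(** * Almost split sequences *)

Section AlmostSplit.
Variable A : pzRingType.
Implicit Types M N K X Y Z C D E W : lmodType A.

Lemma lift_ker X E Z W (f : {linear X -> E}) (g : {linear E -> Z})
    (h : {linear W -> E}) :
  injective f -> (forall y, g y = 0 <-> exists x, f x = y) ->
  (forall w, g (h w) = 0) -> exists s : {linear W -> X}, forall w, f (s w) = h w.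
Proof.
move=> fI ex gh; have H w : exists x, f x = h w by apply/ex.
pose s w := proj1_sig (cid (H w)).
have sE w : f (s w) = h w by rewrite /s; case: cid.
have sl : linear s.
  by move=> a x y; apply: fI; rewrite [RHS]linearP !sE linearP.
by exists (lin_of sl).
Qed.

(** An endomorphism [e] over [Z] has the form [1 + f s]. By locality on [X], either [1 + s f] is
    invertible, and then so is [1 + f s]; or [s f] is invertible, which would split [f]. *)
Lemma almost_split_minimal X E Z (f : {linear X -> E}) (g : {linear E -> Z}) :
  finite_length X -> indecomposable X -> almost_split_sequence f g ->
  right_minimal g.
Proof.
move=> fX iX [fI gS ex [fns _] _] e ge.
have [|s sE] := @lift_ker _ _ _ _ f g (e \- idfun) fI ex.
  by move=> w; rewrite linearB /= ge subrr.
have eE y : e y = y + f (s y) by rewrite sE /= addrC subrK.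
have [|bu|bu] := @indec_local _ X (idfun \+ (s \o f)) (\- (s \o f)) fX iX.
- by move=> x /=; rewrite addrK.
- have /bij_surj uS := bu; apply: inj_surj_bij.
    apply: inj_lin => y ey.
    have [x fx] : exists x, f x = y by apply/ex; rewrite -ge ey linear0.
    suff x0 : x = 0 by rewrite -fx x0 linear0.
    apply: (bij_inj bu); rewrite [RHS]linear0 /=; apply: fI.
    by rewrite linearD linear0 fx -eE.
  (* The usual formula: the inverse of [1 + f s] is [1 - f v s], where [v] is the inverse of
     [1 + s f]. *)
  move=> y; have [w wE] := uS (s y); exists (y - f w).
  have fE : f (s y) = f w + f (s (f w)) by rewrite -wE /= linearD.
  by rewrite eE [s _]linearB [f (_ - _)]linearB fE addrK subrK.
- case: fns; have [u [uK _]] := bij_inverse bu.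
  exists (u \o (\- s)) => x; exact: uK.
Qed.

Lemma right_almost_split_unique E E' Z (g : {linear E -> Z})
    (g' : {linear E' -> Z}) :
  finite_length E -> finite_length E' ->
  right_almost_split g -> right_minimal g ->
  right_almost_split g' -> right_minimal g' ->
  exists2 phi : {linear E -> E'}, bijective phi & forall y, g' (phi y) = g y.
Proof.
move=> fE fE' [ng Lg] mg [ng' Lg'] mg'.
have [h hE] := Lg' _ g fE ng; have [h' hE'] := Lg _ g' fE' ng'.
have /bij_inj b1 := mg (h' \o h) (fun y => etrans (esym (hE' _)) (esym (hE _))).
have /bij_surj b2 := mg' (h \o h') (fun y => etrans (esym (hE _)) (esym (hE' _))).
exists h => //; apply: inj_surj_bij; first by move=> x y e; apply: b1; rewrite /= e.
by move=> y; have [x <-] := b2 y; exists (h' x).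
Qed.

Lemma right_almost_split_iso E E' Z (g : {linear E -> Z}) (g' : {linear E' -> Z})
    (phi : {linear E -> E'}) :
  bijective phi -> (forall y, g' (phi y) = g y) ->
  (right_almost_split g -> right_almost_split g') /\
  (right_minimal g -> right_minimal g').
Proof.
move=> /bij_inverse[psi [phiK psiK]] gE; split=> [[ng Lg]|mg].
  split=> [[s sK]|W h fW nh].
    by apply: ng; exists (psi \o s) => z; rewrite /= -gE psiK sK.
  have [h' hE] := Lg W h fW nh; exists (phi \o h') => w.
  by rewrite /= gE.
move=> e ge; have b : bijective (psi \o e \o phi).
  by apply: mg => y; rewrite /= -gE psiK ge gE.
apply: inj_surj_bij.
  move=> x y exy; rewrite -(psiK x) -(psiK y); congr (phi _).
  by apply: (bij_inj b); rewrite /= !psiK exy.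
move=> y; have [x e1] := bij_surj b (psi y); exists (phi x).
by rewrite -(psiK y) -e1 /= psiK.
Qed.

Lemma almost_split_iso X E E' Z (f : {linear X -> E}) (g : {linear E -> Z})
    (phi : {linear E -> E'}) (f' : {linear X -> E'}) (g' : {linear E' -> Z}) :
  bijective phi -> (forall x, f' x = phi (f x)) -> (forall y, g' (phi y) = g y) ->
  almost_split_sequence f g -> almost_split_sequence f' g'.
Proof.
move=> bphi fE gE [fI gS ex [nf Lf] Rg].
have [psi [phiK psiK]] := bij_inverse bphi; split.
- by move=> x y; rewrite !fE => /(can_inj phiK)/fI.
- by move=> z; have [y <-] := gS z; exists (phi y).
- move=> y; rewrite -(psiK y) gE; split=> [/ex[x <-]|[x]]; first by exists x.
  by rewrite fE => /(can_inj phiK) e; apply/ex; exists x.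
- split=> [[r rK]|W h fW nh].
    by apply: nf; exists (r \o phi) => x; rewrite /= -fE rK.
  have [h' hE] := Lf W h fW nh; exists (h' \o psi) => x.
  by rewrite /= fE phiK.
- exact: (right_almost_split_iso bphi gE).1.
Qed.

Lemma almost_split_source X X' E Z (f : {linear X -> E}) (g : {linear E -> Z})
    (i : {linear X' -> X}) :
  bijective i -> almost_split_sequence f g -> almost_split_sequence (f \o i) g.
Proof.
move=> bi [fI gS ex [nf Lf] Rg]; have [j [iK jK]] := bij_inverse bi; split=> //.
- exact: inj_comp fI (can_inj iK).
- move=> y; rewrite ex; split=> [[x <-]|[x <-]]; last by exists (i x).
  by exists (j x); rewrite /= jK.
- split=> [[r rK]|W h fW nh].
    by apply: nf; exists (i \o r) => x; rewrite /= -{1}(jK x) rK jK.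
  have [|h' hE] := Lf W (h \o j) fW.
    by move=> [r rK]; apply: nh; exists (j \o r) => x; rewrite /= -{1}(iK x) rK iK.
  by exists h' => x; rewrite /= -hE /= iK.
Qed.

(** If [g s = b a] and [b] is not a split epimorphism, then [b = g b']. The endomorphism
    [e = 1 + (b' a - s) r] satisfies [g e = g], hence is invertible by minimality; as [e s = b' a],
    the map [a] splits. *)
Lemma irreducible_component E Z Y (g : {linear E -> Z}) (s : {linear Y -> E}) :
  finite_length E -> right_almost_split g -> right_minimal g ->
  indecomposable Y -> indecomposable Z -> split_mono s ->
  irreducible_map (g \o s).
Proof.
move=> fE [ng Lg] mg iY iZ [r rK].
have nse : ~ split_epi (g \o s) by move=> [t tK]; apply: ng; exists (s \o t).
split=> //.
  move=> [t tK]; apply: nse; exists t.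
  exact: indec_summand iZ iY.1 tK.
move=> W a b fW ab; case: (pselect (split_epi b)) => nb; [by right|left].
have [b' bE] := Lg W b fW nb.
pose e : {linear E -> E} := idfun \+ ((b' \o a \- s) \o r).
have /bij_inverse[e' [eK _]] : bijective e.
  apply: mg => y; rewrite /e /= linearD linearB -bE -ab /=.
  by rewrite subrr addr0.
exists (r \o e' \o b') => y /=.
have -> : b' (a y) = e (s y) by rewrite /e /= rK addrC subrK.
by rewrite eK rK.
Qed.

Lemma irreducible_inj_surj Y Z (f : {linear Y -> Z}) : finite_length Z ->
  irreducible_map f -> injective f \/ (forall z, exists y, f y = z).
Proof.
move=> fZ [_ _ /(_ (submod (imsub f (full_submod Y)))) H].
have fI y : f y \in imsub f (full_submod Y) by exact: imsub_f.
have [h hE] := corestrict fI.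
have [x|[r rK]|[s sK]] := H h val (submod_finite _ fZ); first exact: (esym (hE x)).
- by left=> x y e; rewrite -(rK x) -(rK y); congr (r _); apply: val_inj; rewrite !hE.
- right=> z; have /in_imsub[y _ e] := valP (s z); exists y.
  by rewrite e sK.
Qed.

Lemma isom_prodr Y C D : isom C D -> isom (Y * C)%type (Y * D)%type.
Proof.
move=> [f /bij_inverse[g [fK gK]]].
exists (pairing fst (f \o snd) : {linear (Y * C)%type -> (Y * D)%type}).
by exists (pairing fst (g \o snd) : {linear (Y * D)%type -> (Y * C)%type}) => -[x y];
  rewrite /= ?fK ?gK.
Qed.

Lemma isom_prodCA X Y C :
  isom (X * (Y * C)%type)%type (Y * (X * C)%type)%type.
Proof.
exists (pairing (fst \o snd) (pairing fst (snd \o snd))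
  : {linear (X * (Y * C)%type)%type -> (Y * (X * C)%type)%type}).
by exists (fun z => (z.2.1, (z.1, z.2.2))); case=> [x [y z]].
Qed.

Lemma isom_zero_zero X Y : zero_module X -> zero_module Y -> isom X Y.
Proof.
move=> X0 Y0; exists \0; exists (fun=> 0) => z; first by rewrite (X0 z).
by rewrite (Y0 z).
Qed.

Lemma isom_prod0 Y D : zero_module D -> isom (Y * D)%type Y.
Proof.
move=> D0; exists fst; exists (linl Y D) => // -[y d].
by rewrite (D0 d).
Qed.

Lemma split_mono_comp X Y Z (s : {linear X -> Y}) (t : {linear Y -> Z}) :
  split_mono s -> split_mono t -> split_mono (t \o s).
Proof. by move=> [r rK] [q qK]; exists (r \o q) => x; rewrite /= qK rK. Qed.

Lemma bij_split_mono X Y (s : {linear X -> Y}) : bijective s -> split_mono s.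
Proof. by move=> /bij_inverse[r [rK _]]; exists r. Qed.

Lemma summand_trans X Y Z : is_summand X Y -> is_summand Y Z -> is_summand X Z.
Proof. by move=> [s sS] [t tS]; exists (t \o s); exact: split_mono_comp. Qed.

Lemma isom_summand X Y : isom X Y -> is_summand X Y.
Proof. by move=> [f bf]; exists f; exact: bij_split_mono. Qed.

Lemma linl_summand X C : is_summand X (X * C)%type.
Proof. by exists (linl X C); exists fst. Qed.

Lemma linr_summand X C : is_summand C (X * C)%type.
Proof. by exists (linr X C); exists snd. Qed.

Lemma summand_prod X Y C : finite_length X -> indecomposable X ->
  indecomposable Y -> is_summand X (Y * C)%type -> isom X Y \/ is_summand X C.
Proof.
move=> fX iX iY [s [r rK]].
have [x|/bij_inverse[u [uK _]]|/bij_inverse[u [uK _]]] :=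
  @indec_local _ X (r \o linl Y C \o fst \o s) (r \o linr Y C \o snd \o s) fX iX.
- by rewrite /= -copairE -surjective_pairing rK.
- left; exists (fst \o s : {linear X -> Y}).
  have sK : cancel (fst \o s) (u \o r \o linl Y C) by move=> x; exact: uK.
  exists (u \o r \o linl Y C) => //.
  exact: (@indec_summand _ _ _ (fst \o s) (u \o r \o linl Y C) iY iX.1 sK).
- by right; exists (snd \o s); exists (u \o r \o linr Y C) => x; exact: uK.
Qed.

Lemma summand_complement Y C : finite_length C -> is_summand Y C ->
  exists2 D, finite_length D & isom (Y * D)%type C.
Proof.
move=> fC [s [r rK]]; exists (submod (kersub r)); first exact: submod_finite.
exists (copair s val); apply: inj_surj_bij.
  apply: inj_lin => -[y d] /= e.
  have rd : r (val d) = 0 by apply/eqP; rewrite -in_kersub; exact: valP.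
  have y0 : y = 0 by rewrite -(rK y) -[RHS](linear0 r) -e linearD rd addr0.
  move: e; rewrite y0 linear0 add0r => d0.
  by congr pair; apply: val_inj.
move=> c; have ck : c - s (r c) \in kersub r by rewrite in_kersub linearB /= rK subrr.
by exists (r c, (Sub (c - s (r c)) ck : submod (kersub r))); rewrite /= addrC subrK.
Qed.

Lemma ar_arrow_summand E Z Y (g : {linear E -> Z}) :
  finite_length E -> right_almost_split g -> right_minimal g ->
  ar_vertex Z -> indecomposable Y -> is_summand Y E -> ar_arrow Y Z.
Proof.
move=> fE rg mg vZ iY [s sS]; split=> //.
  split=> //; have [r rK] := sS.
  by have [] := inj_length (can_inj rK) fE.
exists (g \o s); apply: irreducible_component => //; exact: vZ.2.
Qed.

Lemma pow_sum1 Y C : isom (pow_sum Y 1 C) (Y * C)%type.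
Proof.
have pl : linear (fun z : pow_sum Y 1 C => (z.1 ord0, z.2) : Y * C).
  by move=> a x y; apply: injective_projections; rewrite /= ?ffunE.
exists (lin_of pl); exists (fun z => ([ffun=> z.1], z.2)).
  move=> [x c] /=; congr pair; apply/ffunP => i; rewrite ffunE.
  by rewrite (ord1 i).
by move=> [y c] /=; rewrite ffunE.
Qed.

Lemma ar_valuation1 X Y b : finite_length X -> ar_valuation X Y 1 b ->
  exists C (g : {linear (X * C)%type -> Y}),
    [/\ finite_length C, ~ is_summand X C, right_almost_split g &
        right_minimal g].
Proof.
move=> fX [[C [g [fC nXC rg mg]]] _]; have [i bi] := pow_sum1 X C.
have [j [iK jK]] := bij_inverse bi.
have [r m] := @right_almost_split_iso _ _ _ g (g \o j) i bi (fun y => congr1 g (iK y)).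
by exists C, (g \o j); split=> //; [exact: r|exact: m].
Qed.

End AlmostSplit.

(** * The meshes of a homogeneous tube *)

Lemma iter_zainf_tau n (x : int * nat) :
  iter n zainf_tau x = (x.1 - n%:Z, x.2).
Proof.
elim: n => [|n IH] /=; first by rewrite subr0; case: x.
by rewrite IH /zainf_tau /=; congr pair; lia.
Qed.

Lemma zainf_orbitE (x y : int * nat) : zainf_orbit x y <-> x.2 = y.2.
Proof.
split=> [[n]|e]; first by rewrite !iter_zainf_tau => -[] ->.
case: x y e => [i k] [j l] /= ->; exists (absz (i - j)).
rewrite !iter_zainf_tau /=; case: (lerP j i) => ij; [left|right];
  by congr pair; lia.
Qed.

Section Tube.
Variable A : pzRingType.
Implicit Types M N K X Y Z C D E : lmodType A.

(* One module for each of the tau-orbits of Z A_infinity. *)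
Record tube_modules (T : lmodType A -> Prop) (W : nat -> lmodType A) : Prop := {
  tube_vertex : forall X, T X -> ar_vertex X;
  tube_pred : forall X Y, ar_arrow X Y -> T Y -> T X;
  tube_mem : forall n, T (W n);
  tube_all : forall X, T X -> exists n, isom X (W n);
  tube_isom_inj : forall i j, isom (W i) (W j) -> i = j;
  tube_arrow : forall i j, ar_arrow (W i) (W j) <-> (j = i.+1 \/ i = j.+1);
  tube_valuation : forall i j, ar_arrow (W i) (W j) -> ar_valuation (W i) (W j) 1 1;
  tube_tau : forall n, ar_translate (W n) (W n) }.

Lemma homogeneous_tube_modules (T : lmodType A -> Prop) :
  homogeneous_tube T -> exists W, tube_modules T W.
Proof.
move=> [[X0 [_ TE]] [V [TV [allV [isoV [arrV [valV tauV]]]]]]].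
have vT X : T X -> ar_vertex X by move=> /TE[].
exists (fun n => V (0, n)); split=> //.
- move=> X Y XY TY; have [vX vY _] := XY.
  have [_ XY'] := (TE Y).1 TY; apply/TE; split=> //.
  apply: rst_trans XY' _; apply: rst_sym; apply: rst_step.
  by split=> //; right.
- move=> X /allV[[i n] iX]; exists n; apply: isom_trans iX _.
  by apply/(isoV _ _).2/zainf_orbitE.
- by move=> i j /isoV/zainf_orbitE.
- move=> i j; rewrite arrV; split=> [[[a b] /zainf_orbitE/= <-] [] [/= _ ->]|[]->].
  + by left.
  + by right.
  + by exists (0, i.+1); [exact/zainf_orbitE|left].
  + by exists (1, j); [exact/zainf_orbitE|right].
- by move=> i j; exact: valV.
- move=> n; have [E [f [g [fE fg]]]] := tauV (0, n).
  have [i bi] : isom (V (0, n)) (V (zainf_tau (0, n))) by apply/(isoV _ _).2/zainf_orbitE.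
  exists E, (f \o i), g; split=> //; exact: (almost_split_source bi fg).
Qed.

(** The index is shifted so that [tubeQ W t] stands for M[t], with a zero module in degree 0; the
    mesh at the mouth then has the same shape as all others. *)
Definition tubeQ (W : nat -> lmodType A) n : lmodType A :=
  if n is n'.+1 then W n' else submod (zero_submod (W 0%N)).

Section Mesh.
Variables (T : lmodType A -> Prop) (W : nat -> lmodType A).
Hypothesis tW : tube_modules T W.
Local Notation Q := (tubeQ W).

Lemma tubeQ0 : zero_module (Q 0).
Proof. exact/zero_submodP. Qed.

Lemma tubeQ_finite n : finite_length (Q n).
Proof.
case: n => [|n]; first exact/zero_finite/tubeQ0.
exact: (tube_vertex tW (tube_mem tW n)).1.
Qed.

Lemma tubeQ_indec n : indecomposable (Q n.+1).
Proof. exact: (tube_vertex tW (tube_mem tW n)).2. Qed.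

Lemma tube_almost_split n : exists E (f : {linear Q n.+1 -> E})
    (g : {linear E -> Q n.+1}),
  [/\ finite_length E, almost_split_sequence f g, right_almost_split g &
      right_minimal g].
Proof.
have [E [f [g [fE fg]]]] := tube_tau tW n; exists E, f, g.
have mg := almost_split_minimal (tubeQ_finite n.+1) (tubeQ_indec n) fg.
by split=> //; case: fg.
Qed.

Lemma tube_arrow_summand n k : ar_arrow (W k) (W n) ->
  exists C (g : {linear (W k * C)%type -> Q n.+1}),
    [/\ finite_length C, ~ is_summand (W k) C, right_almost_split g &
        right_minimal g].
Proof.
move=> kn; apply: ar_valuation1 (tube_valuation tW kn).
exact: (tubeQ_finite k.+1).
Qed.

Lemma summand_isom X X' C : isom X X' -> is_summand X C -> is_summand X' C.
Proof. by move=> /isom_sym/isom_summand; exact: summand_trans. Qed.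

(** An indecomposable summand of the middle term has an arrow to [W n], so it lies in the same
    component and is one of the neighbours of [W n]. *)
Lemma tube_middle_summand n E (g : {linear E -> Q n.+1}) D :
  finite_length E -> right_almost_split g -> right_minimal g ->
  is_summand D E -> zero_module D \/
  exists k, (k = n.+1 \/ n = k.+1) /\ is_summand (W k) D.
Proof.
move=> fE rg mg DE; case: (pselect (zero_module D)) => D0; [by left|right].
have fD : finite_length D.
  by have [s [r rK]] := DE; have [] := inj_length (can_inj rK) fE.
have [d d0] := nonzero_exists D0.
have [X [s [r [sK iX _]]]] := exists_summand fD d0.
have XD : is_summand X D by exists s; exists r.
have vZ := tube_vertex tW (tube_mem tW n).
have arX := ar_arrow_summand fE rg mg vZ iX (summand_trans XD DE).
have [k Xk] := tube_all tW (tube_pred tW arX (tube_mem tW n)).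
have kD := summand_isom Xk XD; exists k; split=> //.
have /(tube_arrow tW)[] := ar_arrow_summand fE rg mg vZ (tubeQ_indec k)
  (summand_trans kD DE); by auto.
Qed.

(** The valuation says that each neighbour occurs exactly once in the middle term, but each arrow
    supplies its own decomposition. Uniqueness of minimal right almost split maps and cancellation
    allow the two decompositions to be compared. *)
Lemma tube_middle n E (g : {linear E -> Q n.+1}) :
  finite_length E -> right_almost_split g -> right_minimal g ->
  isom E (Q n.+2 * Q n)%type.
Proof.
move=> fE rg mg.
have [C [g1 [fC nC rg1 mg1]]] :=
  tube_arrow_summand ((tube_arrow tW n.+1 n).2 (or_intror erefl)).
have fYC : finite_length (W n.+1 * C)%type.
  by have [] := prod_length (tubeQ_finite n.+2) fC.
have [phi bphi _] := right_almost_split_unique fE fYC rg mg rg1 mg1.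
apply: (@isom_trans _ _ (W n.+1 * C)%type); first by exists phi.
apply: isom_prodr; case: n => [|n] in g g1 rg mg rg1 mg1 nC phi bphi fYC *.
  have [C0|[k [[->|//] kC]]] := tube_middle_summand fYC rg1 mg1 (linr_summand _ _).
    exact: isom_zero_zero tubeQ0.
  by case: nC.
have [C' [g2 [fC' nC' rg2 mg2]]] :=
  tube_arrow_summand ((tube_arrow tW n n.+1).2 (or_introl erefl)).
have fYC' : finite_length (W n * C')%type.
  by have [] := prod_length (tubeQ_finite n.+1) fC'.
have [psi bpsi _] := right_almost_split_unique fYC fYC' rg1 mg1 rg2 mg2.
have iYC : isom (W n * C')%type (W n.+2 * C)%type by apply: isom_sym; exists psi.
have [/(tube_isom_inj tW)|YC] := summand_prod (tubeQ_finite n.+1) (tubeQ_indec n)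
    (tubeQ_indec n.+2) (summand_trans (linl_summand (W n) C') (isom_summand iYC)).
  by lia.
have [D fD iD] := summand_complement fC YC.
have DC : is_summand D C.
  exact: summand_trans (linr_summand _ _) (isom_summand iD).
have [D0|[k [kn kD]]] :=
  tube_middle_summand fYC rg1 mg1 (summand_trans DC (linr_summand _ _)).
  exact: isom_trans (isom_sym iD) (isom_prod0 _ D0).
case: kn => [|[]] e.
  by case: nC; rewrite e in kD; exact: summand_trans kD DC.
rewrite -e in kD.
(* A second copy of [W n] in [D] would survive in [C']: cancelling one copy leaves [C'] isomorphic
   to [W n.+2 * D]. *)
case: nC'; apply: summand_trans kD _.
apply: summand_trans (linr_summand (W n.+2) D) _; apply: isom_summand.
apply: (@cancel_isom _ (W n)) (tubeQ_indec n) _; first exact: (tubeQ_finite n.+1).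
apply: isom_sym; apply: isom_trans iYC _.
apply: isom_trans (isom_prodr _ (isom_sym iD)) _; exact: isom_prodCA.
Qed.

Lemma tube_mesh n : exists (f : {linear Q n.+1 -> (Q n.+2 * Q n)%type})
    (g : {linear (Q n.+2 * Q n)%type -> Q n.+1}), almost_split_sequence f g.
Proof.
have [E [f [g [fE fg rg mg]]]] := tube_almost_split n.
have [phi bphi] := tube_middle fE rg mg.
have [psi [phiK psiK]] := bij_inverse bphi.
exists (phi \o f), (g \o psi).
by apply: (almost_split_iso bphi _ _ fg) => // y; rewrite /= phiK.
Qed.

(** The mesh gives [|Q n.+2| + |Q n| = 2 |Q n.+1|], so the lengths form an arithmetic progression
    starting at 0. *)
Lemma tubeQ_length n : mod_length (Q n) = (n * mod_length (Q 1))%N.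
Proof.
suff H k : mod_length (Q k) = (k * mod_length (Q 1))%N /\
           mod_length (Q k.+1) = (k.+1 * mod_length (Q 1))%N by have [] := H n.
elim: k => [|k [IH1 IH2]].
  by rewrite mul0n mul1n; split=> //; exact/(mod_length0 (tubeQ_finite 0))/tubeQ0.
split=> //; have [f [g [fI gS ex _ _]]] := tube_mesh k.
have [_ e1] := exact_length fI gS ex (tubeQ_finite _) (tubeQ_finite _).
have [_ e2] := prod_length (tubeQ_finite k.+2) (tubeQ_finite k).
by rewrite e2 IH1 IH2 in e1; nia.
Qed.

Lemma tubeQ1_gt0 : (0 < mod_length (Q 1))%N.
Proof.
rewrite lt0n; apply/eqP => /(mod_length0 (tubeQ_finite 1)).
exact: (tubeQ_indec 0).1.
Qed.

Lemma tubeQ_isom_inj i j : isom (Q i) (Q j) -> i = j.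
Proof.
move=> /isom_length/(_ (tubeQ_finite j))[_]; rewrite (tubeQ_length i) (tubeQ_length j) => /eqP.
by rewrite eqn_pmul2r ?tubeQ1_gt0 // => /eqP.
Qed.

Lemma linr_comp_irreducible n (f : {linear Q n.+1 -> (Q n.+2 * Q n)%type})
    (g : {linear (Q n.+2 * Q n)%type -> Q n.+1}) k
    (s : {linear Q k.+1 -> (Q n.+2 * Q n)%type}) :
  almost_split_sequence f g -> split_mono s -> irreducible_map (g \o s).
Proof.
move=> fg sS; have [_ _ _ _ rg] := fg.
have mg := almost_split_minimal (tubeQ_finite n.+1) (tubeQ_indec n) fg.
apply: irreducible_component => //.
- by have [] := prod_length (tubeQ_finite n.+2) (tubeQ_finite n).
- exact: tubeQ_indec.
- exact: tubeQ_indec.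
Qed.

(** The map [Q 1 -> Q 0] to the zero module is a split epimorphism, hence never irreducible; this
    explains the exception. *)
Definition mesh_ok n (p : {linear Q n.+1 -> Q n}) :=
  n = 0%N \/ irreducible_map p.

(** As [p] is not a split monomorphism, [p = h f]; being irreducible, it makes [h] a split
    epimorphism. By locality the component [x] or [y] of [h] accounts for the splitting; [x] cannot,
    since [Q n.+2] and [Q n] are indecomposable of different lengths. So [y] is invertible, and [h]
    may serve as second coordinate of the middle term. *)
Lemma tube_mesh_step n (p : {linear Q n.+1 -> Q n}) : mesh_ok p ->
  exists (a : {linear Q n.+1 -> Q n.+2}) (p' : {linear Q n.+2 -> Q n.+1})
         (d : {linear Q n -> Q n.+1}),
  [/\ almost_split_sequence (pairing a p) (copair p' d), irreducible_map p' &
      injective d].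
Proof.
move=> pok; have [f [g fg]] := tube_mesh n; have [_ _ _ [nf Lf] _] := fg.
have [h [bh hf]] : exists h : {linear (Q n.+2 * Q n)%type -> Q n},
    bijective (fun z => (z.1, h z)) /\ forall x, h (f x) = p x.
  case: n => [|n] in p pok f g fg nf Lf *.
    exists snd; split; first by exists id => -[].
    by move=> x; rewrite (tubeQ0 (p x)); exact: tubeQ0.
  case: pok => // -[np _ ip].
  have [h hE] := Lf _ p (tubeQ_finite _) np; exists h; split=> //.
  have [fP _] := prod_length (tubeQ_finite n.+3) (tubeQ_finite n.+1).
  have [//|[s sK]] := ip _ f h fP hE.
  pose x : {linear Q n.+3 -> Q n.+1} := h \o linl (Q n.+3) (Q n.+1).
  pose y : {linear Q n.+1 -> Q n.+1} := h \o linr (Q n.+3) (Q n.+1).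
  have by_ : bijective y.
    have [z||b] := @indec_local _ (Q n.+1) (x \o fst \o s) (y \o snd \o s)
      (tubeQ_finite _) (tubeQ_indec n).
    - by rewrite /= -copairE -surjective_pairing sK.
    - move=> /bij_inverse[u [uK _]].
      have tK : cancel (fst \o s) (u \o x) by move=> z; exact: uK.
      have e := @indec_summand _ _ _ (fst \o s) (u \o x) (tubeQ_indec n.+2)
        (tubeQ_indec n).1 tK.
      have /tubeQ_isom_inj : isom (Q n.+1) (Q n.+3) by exists (fst \o s); exists (u \o x).
      by lia.
    - apply: endo_surj_bij (tubeQ_finite _) _ => z.
      by have [w <-] := bij_surj b z; exists (s w).2.
  have [y' [yK y'K]] := bij_inverse by_.
  have hxy u v : h (u, v) = x u + y v by rewrite copairE.
  exists (fun z => (z.1, y' (z.2 - x z.1))) => -[u v] /=; congr pair.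
    by rewrite hxy addrC addKr yK.
  by rewrite hxy [y _]y'K addrC subrK.
pose phi : {linear (Q n.+2 * Q n)%type -> (Q n.+2 * Q n)%type} := pairing fst h.
have bphi : bijective phi := bh.
have [psi [phiK psiK]] := bij_inverse bphi.
pose p' := g \o psi \o linl (Q n.+2) (Q n).
pose d := g \o psi \o linr (Q n.+2) (Q n).
have fg' : almost_split_sequence (pairing (fst \o f) p) (copair p' d).
  apply: (almost_split_iso bphi _ _ fg).
    by move=> x; apply: injective_projections; rewrite //= hf.
  move=> y; rewrite -{2}(phiK y); case: (phi y) => u v.
  exact: (esym (copairE (g \o psi) u v)).
have splitpsi M (s : {linear M -> (Q n.+2 * Q n)%type}) :
    split_mono s -> split_mono (psi \o s).
  by move=> [r rK]; exists (r \o phi) => x; rewrite -[RHS]rK; congr (r _); exact: psiK.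
exists (fst \o f), p', d; split=> //.
  apply: (linr_comp_irreducible (s := psi \o linl _ _) fg).
  by apply: splitpsi; exists fst.
case: n => [|n] in p pok f g fg nf Lf h bh hf phi bphi psi phiK psiK p' d fg' splitpsi *.
  by move=> x y _; rewrite (tubeQ0 x) (tubeQ0 y).
have : irreducible_map d.
  apply: (linr_comp_irreducible (s := psi \o linr _ _) fg).
  by apply: splitpsi; exists snd.
(* An irreducible map is injective or surjective, and [d] goes from a shorter module to a longer
   one. *)
case/(irreducible_inj_surj (tubeQ_finite _)) => // dS.
have [le _] := surj_length dS (tubeQ_finite _).
have := tubeQ1_gt0; rewrite (tubeQ_length n.+2) (tubeQ_length n.+1) in le; nia.
Qed.

(** Dependent choice: the map [p'] produced at one level is handed to the next one as the prescribed
    component, starting from the zero map. *)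
Lemma tube_meshes : exists (p : forall n, {linear Q n.+1 -> Q n})
    (a : forall n, {linear Q n.+1 -> Q n.+2})
    (d : forall n, {linear Q n -> Q n.+1}),
  (forall n, almost_split_sequence (pairing (a n) (p n)) (copair (p n.+1) (d n))) /\
  forall n, injective (d n).
Proof.
pose ok n := {p : {linear Q n.+1 -> Q n} | mesh_ok p}.
have next n (p : ok n) : {q : ok n.+1 | exists a d,
    almost_split_sequence (pairing a (sval p)) (copair (sval q) d) /\ injective d}.
  apply: cid; have [a [p' [d [ass ir dI]]]] := tube_mesh_step (proj2_sig p).
  by exists (exist _ p' (or_intror ir)), a, d.
pose P0 : ok 0%N :=
  exist (fun p : {linear Q 1 -> Q 0} => mesh_ok p) \0 (or_introl erefl).
pose P := fix P n : ok n :=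
  if n is n'.+1 then sval (next n' (P n')) else P0.
have PS n := proj2_sig (next n (P n)).
pose a n := proj1_sig (cid (PS n)); have aP n := proj2_sig (cid (PS n)).
pose d n := proj1_sig (cid (aP n)); have dP n := proj2_sig (cid (aP n)).
by exists (fun n => sval (P n)), a, d; split=> n; have [] := dP n.
Qed.

End Mesh.
End Tube.

(** * Submodules of the modules in a homogeneous tube *)

Section TubeSubmodules.
Variable A : pzRingType.
Implicit Types M N X Y : lmodType A.

Lemma simple_length M : simple_module M ->
  finite_length M /\ (mod_length M <= 1)%N.
Proof.
move=> [M0 sM]; have h : has_length M 1.
  exists (zero_submod M); split=> //; split; first exact: zero_proper.
  move=> W [[_ W0] [_ Wf]]; case: (sM W) => e.
    by apply: W0 => x; rewrite e.
  by apply: Wf => x _; rewrite e.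
by have [? ->] := has_lengthE h.
Qed.

(** Links the length measured inside [M] with the length of [submod U] as a module. *)
Lemma clen_submod M n (U : submodClosed M) : clen n U ->
  mod_length (submod U) = n.
Proof.
move=> nU; have [|_ -> //] := @has_lengthE A (submod U) n.
rewrite /has_length -(add0n n).
have -> : full_submod (submod U) = presub (val : {linear submod U -> M}) U.
  by apply: submod_ext => x; rewrite in_presub; apply/esym; exact: valP.
apply: (clen_presub _ _ nU); first by rewrite im_val_full.
by apply: kersub_inj; exact: val_inj.
Qed.

Lemma submod_clen M (U : submodClosed M) : finite_length M ->
  clen (mod_length (submod U)) U.
Proof.
move=> /(submod_finite U)/finite_has_length h.
have [k _] := clen_imsub (val : {linear submod U -> M}) h.
by rewrite im_val_full => kU; rewrite (clen_submod kU).
Qed.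

Variables (T : lmodType A -> Prop) (W : nat -> lmodType A).
Hypothesis tW : tube_modules T W.
Local Notation Q := (tubeQ W).
Variables (p : forall n, {linear Q n.+1 -> Q n})
  (a : forall n, {linear Q n.+1 -> Q n.+2}) (d : forall n, {linear Q n -> Q n.+1}).
Hypothesis ass :
  forall n, almost_split_sequence (pairing (a n) (p n)) (copair (p n.+1) (d n)).
Hypothesis d_inj : forall n, injective (d n).
Local Notation q := (mod_length (Q 1)).
Local Notation fQ := (tubeQ_finite tW).
Local Notation iQ := (tubeQ_indec tW).

(** * Kernels of the maps [p n] and lifting along them *)

Lemma mesh_comp n w : p n.+1 (a n w) = - d n (p n w).
Proof.
have [_ _ ex _ _] := ass n; apply/eqP; rewrite -addr_eq0; apply/eqP.
by apply: (ex (a n w, p n w)).2; exists w.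
Qed.

(** Every element is [p x + d z] by the mesh; by induction [z = p w], and [d (p w) = - p (a w)]
    absorbs the second term. *)
Lemma p_surj n y : exists x, p n x = y.
Proof.
elim: n y => [|n IH] y; first by exists 0; rewrite (tubeQ0 (W := W) y) linear0.
have [_ gS _ _ _] := ass n; have [[x z] /= <-] := gS y.
have [w <-] := IH z; exists (x - a n w).
by rewrite linearB mesh_comp opprK.
Qed.

(** The right almost split map gives [h = p k1 + d k2]. By induction [k2 = p v], so
    [h = p (k1 - a v)]. The descent to smaller [t] is why split epimorphisms are excluded at every
    level. *)
Lemma p_lift N : finite_length N ->
  (forall t (h : {linear N -> Q t.+1}), ~ split_epi h) ->
  forall t (h : {linear N -> Q t}),
    exists h' : {linear N -> Q t.+1}, forall x, p t (h' x) = h x.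
Proof.
move=> fN nN; elim=> [|t IH] h.
  by exists \0 => x; rewrite linear0 (tubeQ0 (W := W) (h x)).
have [_ _ _ _ [_ L]] := ass t; have [k kE] := L N h fN (nN t h).
have [v vE] := IH (snd \o k); exists ((fst \o k) \- (a t \o v)) => x.
by rewrite linearB /= mesh_comp opprK vE kE.
Qed.

(** The map [a n] carries the kernel of [p n] onto that of [p n.+1]: if [p n.+1] kills [x], then
    [(x, 0)] is in the kernel of the mesh map, hence equals [(a n w, p n w)] for some [w]. *)
Lemma ker_embedding n : exists k : {linear Q 1 -> Q n.+1},
  injective k /\ forall x, p n x = 0 <-> exists z, k z = x.
Proof.
elim: n => [|n [k [kI kE]]].
  exists idfun; split=> // x; split=> [_|_]; first by exists x.
  exact: tubeQ0.
have [fI _ ex _ _] := ass n; exists (a n \o k); split=> [|x].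
  have pk z : p n (k z) = 0 by apply/kE; exists z.
  by move=> y z /= e; apply: kI; apply: fI; rewrite /= e !pk.
split=> [px|[z <-]]; last first.
  have -> : p n.+1 ((a n \o k) z) = - d n (p n (k z)) by exact: mesh_comp.
  by rewrite ((kE (k z)).2 _) ?linear0 ?oppr0 //; exists z.
have [|w /= [aw pw]] := (ex (x, 0)).1; first by rewrite /= px linear0 addr0.
by have [z kz] := (kE w).1 pw; exists z; rewrite /= kz.
Qed.

Lemma embedding_tower m : exists k : {linear Q 1 -> Q m.+1}, injective k.
Proof. by have [k [kI _]] := ker_embedding m; exists k. Qed.

(** * Submodules of length at most that of [Q 1], and part (a) *)

Lemma small_no_split_epi N : finite_length N -> (mod_length N <= q)%N ->
  ~ isom N (Q 1) -> forall t (h : {linear N -> Q t.+1}), ~ split_epi h.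
Proof.
move=> fN lN nN t h [s sK].
have hS y : exists x, h x = y by exists (s y).
have [le bi] := surj_length hS fN; rewrite (tubeQ_length tW t.+1) in le bi.
have q0 := tubeQ1_gt0 tW.
have t0 : t = 0%N by nia.
subst t; apply: nN; exists h; apply: bi; lia.
Qed.

(** Let [h] be the map from [N] onto its image in the next lower module and [s] a lift of that
    image. Elements not killed by [h] are handled by induction; the others are detected by
    [f - s h], which takes values in the kernel of [p m], a copy of [Q 1]. *)
Lemma small_cogenerated m N (f : {linear N -> Q m}) :
  injective f -> finite_length N -> (mod_length N <= q)%N ->
  ~ isom N (Q 1) ->
  forall x, x <> 0 -> exists g : {linear N -> Q 1}, g x <> 0.
Proof.
elim: m N f => [|m IH] N f fI fN lN nN x x0.
  by case: x0; apply: fI; rewrite linear0; exact: tubeQ0.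
pose I := imsub (p m \o f) (full_submod N).
have hI z : (p m \o f) z \in I by exact: imsub_f.
have [h hE] := corestrict hI.
have hS y : exists z, h z = y.
  by have /in_imsub[z _ e] := valP y; exists z; apply: val_inj; rewrite hE.
have [lI bI] := surj_length hS fN; have fin := surj_finite hS fN.
(* An image isomorphic to [Q 1] would have length at least [|N|], so [h] would be bijective and [N]
   isomorphic to [Q 1]. *)
have nI : ~ isom (submod I) (Q 1).
  move=> iI; apply: nN; apply: isom_trans (iI); exists h; apply: bI.
  by apply/eqP; rewrite eqn_leq lI andbT (isom_length iI (fQ 1)).2.
have lI' := leq_trans lI lN.
have [s sE] := p_lift fin (small_no_split_epi fin lI' nI)
  (val : {linear submod I -> Q m}).
case: (pselect (h x = 0)) => hx; last first.
  have [g gx] := IH _ (val : {linear submod I -> Q m}) (@submod_val_inj _ _ I)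
    fin lI' nI _ hx.
  by exists (g \o h).
have [k [kI kE]] := ker_embedding m.
have [|g gE] := @lift_ker _ _ _ _ _ k (p m) (f \- (s \o h)) kI kE.
  move=> z; rewrite linearB; apply/eqP; rewrite subr_eq0; apply/eqP.
  by rewrite [RHS]sE; exact: (esym (hE z)).
exists g => gx; apply: x0; apply: fI; rewrite linear0.
by have := gE x; rewrite gx linear0 /= hx [s 0]linear0 subr0.
Qed.

Lemma small_measure m N (f : {linear N -> Q m}) :
  injective f -> finite_length N -> indecomposable N -> (mod_length N <= q)%N ->
  ~ isom N (Q 1) -> gr_measure N < gr_measure (Q 1).
Proof.
move=> fI fN iN lN nN.
have [||le eq] := @gr_main_property A N (gr_measure (Q 1))
    (fun Y _ => isom Y (Q 1)) fN iN.
- move=> Y _ iY; have [fY _] := isom_length iY (fQ 1).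
  split=> //; first exact: indec_isom (isom_sym iY) (iQ 0).
  by rewrite (gr_isom (fQ 1) iY).
- move=> x /(small_cogenerated fI fN lN nN)[g gx].
  by exists (Q 1), g; split=> //; exact: isom_refl.
rewrite lt_neqAle le andbT; apply/eqP => /eq[Y [g [iY bg]]].
by apply: nN; apply: isom_trans iY; exists g.
Qed.

(* Being in [beyond X] says that, in the lexicographic order of the sets of
   lengths coded by the measures, [X] is above [Q 1] up to its own length. *)
Definition beyond X : Prop :=
  (q < mod_length X)%N /\ gr_measure (Q 1) < gr_measure X + half (mod_length X).

(** If [|X'| <= q], then [X'] is below [Q 1] by at least [half q], whereas [X] together with the
    slack adds [2 * half |X| <= half q], a contradiction. If [|X'| > q], the slack [half |X'|]
    covers [2 * half |X|], so [X'] inherits the inequality. *)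
Lemma beyond_step m X X' (f : {linear X -> Q m}) (i : {linear X' -> X}) :
  injective f -> injective i -> finite_length X -> indecomposable X' ->
  (mod_length X' < mod_length X)%N ->
  gr_measure X = gr_measure X' + half (mod_length X) -> beyond X ->
  isom X' (Q 1) \/ beyond X'.
Proof.
move=> fI iI fX iX' ltX eX [lX gX]; have [fX' _ _] := inj_length iI fX.
case: (pselect (isom X' (Q 1))) => nX'; [by left|right].
case: (leqP (mod_length X') q) => lX'.
  have lt := small_measure (inj_comp fI iI : injective (f \o i)) fX' iX' lX' nX'.
  have d1 := dyadic_le lX' (gr_dyadic fX').1; have [d2 _] := gr_dyadic (fQ 1).
  have gap := dyadic_gap d1 d2 lt.
  have h1 := half_le lX; have h2 := half_S q.
  exfalso; move: gap h1 h2 gX; rewrite eX.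
  move: (gr_measure X') (gr_measure (Q 1)) (half q) (half q.+1)
    (half (mod_length X)) => x y b c e; lra.
split=> //; have h1 := half_le ltX; have h2 := half_S (mod_length X').
move: h1 h2 gX; rewrite eX.
move: (gr_measure X') (gr_measure (Q 1)) (half (mod_length X'))
  (half (mod_length X').+1) (half (mod_length X)) => x y b c e; lra.
Qed.

Lemma beyond_tube m : beyond (Q m.+2).
Proof.
split; first by rewrite (tubeQ_length tW m.+2); have := tubeQ1_gt0 tW; nia.
have [k kI] := embedding_tower m.+1; have := gr_le kI (fQ m.+2).
have := half_gt0 (mod_length (Q m.+2)).
move: (gr_measure (Q 1)) (gr_measure (Q m.+2)) (half _) => x y z; lra.
Qed.

(** Descent through Gabriel-Roiter submodules: it must meet [Q 1], because a module in [beyond] has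
    length above [q >= 1] and is therefore not simple. *)
Lemma beyond_embeds m X (f : {linear X -> Q m}) : injective f ->
  finite_length X -> indecomposable X -> beyond X ->
  exists e : {linear Q 1 -> X}, injective e.
Proof.
have [n] := ubnP (mod_length X); elim: n X f => // n IH X f le fI fX iX bX.
have nX : ~ simple_module X.
  move=> /simple_length[_ l1]; have [lX _] := bX.
  by have := tubeQ1_gt0 tW; lia.
have [X' [i [iI iS iX' eX]]] := gr_sub_exists fX iX nX.
have [fX' lX' bX'] := inj_length iI fX.
have ltX : (mod_length X' < mod_length X)%N.
  by rewrite ltn_neqAle lX' andbT; apply/eqP => /bX'/bij_surj.
have [/isom_sym[e be]|b] := beyond_step fI iI fX iX' ltX eX bX.
  by exists (i \o e); exact: inj_comp iI (bij_inj be).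
have [|e eI] := IH X' (f \o i) _ (inj_comp fI iI) fX' iX' b.
  exact: leq_trans ltX le.
by exists (i \o e); exact: inj_comp iI eI.
Qed.

Lemma gr_filtration_tube m M (phi : {linear M -> Q m.+2}) t
    (F : nat -> submodClosed M) :
  bijective phi -> gr_filtration t F ->
  exists i, (1 <= i <= t)%N /\ isom (submod (F i)) (Q 1).
Proof.
move=> bphi [t1 indF simF Ft grF]; apply: contrapT => H.
have [fM lM] := bij_length bphi (fQ _).
have fF i := submod_finite (F i) fM.
(* Downward induction from the full module; at [j = t - 1] the simple module [F 1] would have length
   greater than [q]. *)
suff b j : (j < t)%N -> beyond (submod (F (t - j)%N)).
  have := b (t - 1)%N; rewrite subKn // => -[]; first by lia.
  have [_] := simple_length simF; have := tubeQ1_gt0 tW; lia.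
elim: j => [_|j IH lt].
  rewrite subn0 (submod_ext Ft) /beyond.
  have iM : isom (submod (full_submod M)) (Q m.+2).
    by apply: isom_trans (isom_full M) _; exists phi.
  have [_ ->] := isom_length iM (fQ _).
  by rewrite (gr_isom (fQ _) iM); exact: beyond_tube.
have b := IH (ltnW lt).
have [|_ _ iX' [sX pX] eX] := grF (t - j)%N; first by lia.
have e1 : (t - j).-1 = (t - j.+1)%N by lia.
rewrite e1 in iX' sX pX eX; have [i iE] := incl_exists sX.
have iI : injective i by move=> x y e; apply: val_inj; rewrite -!iE e.
have lX : (mod_length (submod (F (t - j.+1)%N)) < mod_length (submod (F (t - j)%N)))%N.
  have [le eqX] := subset_length fM sX; rewrite ltn_neqAle le andbT.
  by apply/eqP => /eqX e; apply: pX; rewrite e.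
have fI : injective (phi \o (val : {linear submod (F (t - j)%N) -> M})).
  exact: inj_comp (bij_inj bphi) val_inj.
have [||//] := beyond_step fI iI (fF _) iX' lX _ b.
  by rewrite /half -eX addrC subrK.
by move=> iso; case: H; exists (t - j.+1)%N; split=> //; lia.
Qed.

(* [socle j m] is the submodule of length [j] in the uniserial filtration of
   [Q m], for [j <= m]. *)
Fixpoint socle j m : submodClosed (Q m) :=
  match j, m with
  | 0%N, _ => zero_submod _
  | j'.+1, m'.+1 => presub (p m') (socle j' m')
  | _, 0%N => full_submod _
  end.

Lemma socle_clen j m : (j <= m)%N -> clen (j * q) (socle j m).
Proof.
elim: j m => [|j IH] [|m] //= jm; rewrite mulSn; apply: clen_presub.
- by move=> y _; have [x <-] := p_surj y; exact: imsub_f.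
- have kl := ker_length (@p_surj m) (fQ m.+1).
  rewrite (tubeQ_length tW m.+1) (tubeQ_length tW m) in kl.
  have -> : q = mod_length (submod (kersub (p m))) by lia.
  by apply: submod_clen; exact: (fQ m.+1).
- exact: IH.
Qed.

Lemma socle_length j m : (j <= m)%N ->
  mod_length (submod (socle j m)) = (j * q)%N.
Proof. by move=> jm; apply: clen_submod; exact: socle_clen. Qed.

Lemma socle_full j m : (m <= j)%N -> socle j m = full_submod (Q m).
Proof.
elim: j m => [|j IH] [|m] //= jm.
  apply: submod_ext => x; rewrite (tubeQ0 (W := W) x).
  by rewrite in_zero_submod eqxx in_full_submod.
by apply: submod_ext => x; rewrite in_presub (IH m jm).
Qed.

Lemma socle_le j j' m : (j <= j')%N -> {subset socle j m <= socle j' m}.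
Proof.
elim: j j' m => [|j IH] j' m jj x.
  by rewrite in_zero_submod => /eqP->; exact: rpred0.
by case: j' m jj x => [|j'] [|m] //= jj x; rewrite !in_presub; exact: IH.
Qed.

(** * The case where [Q 1] is a brick, and part (b) *)

Hypothesis brickQ : brick (Q 1).

Lemma brick_endo (f : {linear Q 1 -> Q 1}) x : f x <> 0 -> bijective f.
Proof.
move=> fx; have [_ H] := brickQ; have [|g [fK gK]] := H f; first by exists x.
by exists g.
Qed.

(** Suppose [p f] is nonzero. By induction its image lies in the next kernel, a copy of the brick,
    as does the image of [d k']; comparing both yields [y] with [d y = p f]. Then [(f, - y)] factors
    through the mesh as [(a w, p w)], and [p w = 0] by induction, so [y] vanishes and [p f] with
    it. *)
Lemma brick_hom n (f : {linear Q 1 -> Q n.+1}) x : p n (f x) = 0.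
Proof.
elim: n f x => [|n IH] f x; first exact: tubeQ0.
apply: contrapT => pfx.
have [k [kI kE]] := ker_embedding n.
have [th thE] := @lift_ker _ _ _ _ _ k (p n) (p n.+1 \o f) kI kE (IH (p n.+1 \o f)).
have bth : bijective th.
  by apply: (@brick_endo th x) => e; apply: pfx; rewrite -[LHS]thE e linear0.
case: n => [|n] in f x pfx k kI kE th thE bth IH *.
  have bk : bijective k.
    by apply: endo_inj_bij kI; exact: fQ.
  (* At the bottom [p 1 f] is a nonzero endomorphism of the brick, so [f] would split and the
     indecomposable [Q 2] would be isomorphic to [Q 1]. *)
  have /bij_inverse[u [uK _]] : bijective (p 1 \o f).
    by apply: (@brick_endo (p 1 \o f) x).
  have := @indec_summand _ _ _ f (u \o p 1) (iQ 1) (iQ 0).1 uK => fK.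
  have /(tubeQ_isom_inj tW) : isom (Q 1) (Q 2) by exists f; exists (u \o p 1).
  by [].
have [k' [k'I k'E]] := ker_embedding n.
have [th' th'E] := @lift_ker _ _ _ _ _ k (p n.+1) (d n.+1 \o k') kI kE
  (IH (d n.+1 \o k')).
have [z z0] := nonzero_exists brickQ.1.
have bth' : bijective th'.
  apply: (@brick_endo th' z) => e; apply: z0; apply: k'I; apply: d_inj.
  by rewrite -[LHS]th'E e !linear0.
have [u [_ uK]] := bij_inverse bth'.
pose y : {linear Q 1 -> Q n.+1} := k' \o u \o th.
have yE w : d n.+1 (y w) = p n.+2 (f w).
  by rewrite -[LHS]th'E /= uK thE.
have [fI _ ex _ _] := ass n.+1.
have [|w wE] := @lift_ker _ _ _ _ _ (pairing (a n.+1) (p n.+1))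
    (copair (p n.+2) (d n.+1)) (pairing f (\- y)) fI ex.
  by move=> w; rewrite /= linearN [d _ _]yE subrr.
have yx : y x = 0.
  by have := congr1 snd (wE x); rewrite /= IH => /esym/eqP; rewrite oppr_eq0 => /eqP.
by apply: pfx; rewrite -yE yx linear0.
Qed.

Lemma brick_image n (f : {linear Q 1 -> Q n.+1}) y :
  (exists x, f x <> 0) -> p n y = 0 -> exists x, f x = y.
Proof.
move=> [x fx] py; have [k [kI kE]] := ker_embedding n.
have [th thE] := @lift_ker _ _ _ _ _ k (p n) f kI kE (brick_hom f).
have /bij_surj thS : bijective th.
  by apply: (@brick_endo th x) => e; apply: fx; rewrite -thE e linear0.
have [z <-] := (kE y).1 py; have [w <-] := thS z; exists w.
by rewrite thE.
Qed.

Lemma surj_factor (X Y Z : lmodType A) (g : {linear X -> Y}) (h : {linear X -> Z}) :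
  (forall y, exists x, g x = y) -> (forall x, g x = 0 -> h x = 0) ->
  exists k : {linear Y -> Z}, forall x, k (g x) = h x.
Proof.
move=> gS gh; pose s y := proj1_sig (cid (gS y)).
have sE y : g (s y) = y by rewrite /s; case: cid.
have kE x : h (s (g x)) = h x.
  by apply/eqP; rewrite -subr_eq0 -linearB gh // linearB /= sE subrr.
have kl : linear (h \o s).
  move=> c x y /=; rewrite -{1}(sE x) -{1}(sE y) -linearP kE.
  exact: linearP.
by exists (lin_of kl).
Qed.

(** By [brick_hom], [f] maps the kernel of [p] into the kernel of [p], so it induces a map one level
    down; by [brick_image] it fills that kernel, so the induced map is again injective. *)
Lemma inj_socle j m (f : {linear Q j -> Q m}) : injective f ->
  forall x, f x \in socle j m.
Proof.
elim: j m f => [|j IH] [|m] f fI x //=.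
- by rewrite (tubeQ0 (W := W) x) linear0 rpred0.
- by rewrite (tubeQ0 (W := W) x) linear0 rpred0.
have [k [kI kE]] := ker_embedding j.
have [z z0] := nonzero_exists brickQ.1.
have fk0 : exists x, (f \o k) x <> 0.
  by exists z => e; apply: z0; apply: kI; apply: fI; rewrite [LHS]e !linear0.
have [|f' f'E] := @surj_factor _ _ _ (p j) (p m \o f) (@p_surj j).
  by move=> y /kE[w <-]; exact: (brick_hom (f \o k)).
have f'I : injective f'.
  apply: inj_lin => y; have [w <-] := p_surj y; rewrite f'E => /= pf.
  have [v e] := brick_image fk0 pf; apply/kE; exists v; exact: fI.
by rewrite in_presub -[p m (f x)]f'E; exact: IH.
Qed.

Lemma inj_image_socle j m (f : {linear Q j -> Q m}) : injective f ->
  (j <= m)%N -> imsub f (full_submod _) = socle j m.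
Proof.
move=> fI jm; have sub : {subset imsub f (full_submod _) <= socle j m}.
  by move=> y /in_imsub[x _ <-]; exact: inj_socle.
have [_] := subset_length (fQ m) sub; apply.
have [_ <-] := isom_length (isom_im_full fI) (submod_finite _ (fQ m)).
by rewrite (tubeQ_length tW j) socle_length.
Qed.

(** Induction on [m]. If [U] misses part of the kernel of [p], no nonzero map from [Q 1] lands in
    [U], and [Y = U] works. Otherwise the splitting of the image of [U] is pulled back: the socle
    part by preimage, the complement by a lift. *)
Lemma submod_splits m (U : submodClosed (Q m)) : exists j (Y : submodClosed (Q m)),
  [/\ {subset socle j m <= U}, {subset Y <= U},
      forall x, x \in U -> exists k y, [/\ k \in socle j m, y \in Y & x = k + y],
      forall x, x \in socle j m -> x \in Y -> x = 0 &
      forall g : {linear Q 1 -> Q m}, (forall z, g z \in Y) -> forall z, g z = 0].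
Proof.
elim: m U => [|m IH] U.
  exists 0%N, U; split=> //.
  - by move=> x; rewrite in_zero_submod => /eqP->; exact: rpred0.
  - by move=> x xU; exists 0, x; rewrite rpred0 add0r.
  - by move=> x _ _; exact: tubeQ0.
  - by move=> g _ z; exact: tubeQ0.
case: (pselect {subset kersub (p m) <= U}) => kU; last first.
  exists 0%N, U; split=> //.
  - by move=> x; rewrite in_zero_submod => /eqP->; exact: rpred0.
  - by move=> x xU; exists 0, x; rewrite rpred0 add0r.
  - by move=> x; rewrite in_zero_submod => /eqP.
  move=> g gU z; apply: contrapT => gz; apply: kU => x; rewrite in_kersub => /eqP px.
  by have [w <-] := brick_image (ex_intro _ z gz) px.
have pU x : p m x \in imsub (p m) U -> x \in U.
  case/in_imsub => u uU e; rewrite -(subrK u x) rpredD // kU // in_kersub.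
  by rewrite linearB /= e subrr.
have [j [Y [jU YU dec dis hom]]] := IH (imsub (p m) U).
have fY := submod_finite Y (fQ m).
(* A section would embed [Q t.+1], and with it [Q 1], into [Y], against the last property of [Y]. *)
have nY t (h : {linear submod Y -> Q t.+1}) : ~ split_epi h.
  move=> [r rK]; have [k [kI _]] := ker_embedding t.
  have [z z0] := nonzero_exists brickQ.1; apply: z0; apply: kI.
  apply: (can_inj rK); rewrite !linear0; apply: val_inj.
  by apply: (hom (val \o r \o k)) => w; exact: valP.
have [s sE] := p_lift fY nY (val : {linear submod Y -> Q m}).
exists j.+1, (imsub s (full_submod _)); split.
- by move=> x /=; rewrite in_presub => /jU; exact: pU.
- by move=> x /in_imsub[y _ <-]; apply: pU; rewrite sE; apply: YU; exact: valP.
- move=> x xU; have [k [y [kj yY e]]] := dec (p m x) (imsub_f _ xU).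
  pose y' : submod Y := Sub y yY.
  exists (x - s y'), (s y'); split; last by rewrite subrK.
    by rewrite /= in_presub linearB /= sE e addrK.
  exact: imsub_f.
- move=> x xj /in_imsub[y _ e]; rewrite -e in xj *.
  rewrite /= in_presub sE in xj; have y0 := dis _ xj (valP y).
  by rewrite (_ : y = 0) ?linear0 //; apply: val_inj.
- move=> g gY z; have /in_imsub[y _ e] := gY z.
  have pg w : (p m \o g) w \in Y.
    by have /in_imsub[y' _ e'] := gY w; rewrite /= -e' sE; exact: valP.
  have y0 : val y = 0 by rewrite -sE e; exact: (hom _ pg z).
  by rewrite -e (_ : y = 0) ?linear0 //; apply: val_inj.
Qed.

(** One of the two summands vanishes. It is not the socle part, for then the kernel, a copy of
    [Q 1], would lie in [Y]. *)
Lemma indec_is_socle m (U : submodClosed (Q m.+1)) :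
  indecomposable (submod U) -> {subset kersub (p m) <= U} ->
  exists j, U = socle j m.+1.
Proof.
move=> [_ iU] kU; have [j [Y [jU YU dec dis hom]]] := submod_splits U.
exists j; pose v : {linear submod U -> Q m.+1} := val.
have z0 (V : submodClosed (Q m.+1)) : {subset V <= U} ->
    presub v V =i zero_submod _ -> forall x, x \in V -> x = 0.
  move=> VU e x xV; have := e (Sub x (VU x xV)).
  rewrite in_presub in_zero_submod /v /= xV => /esym/eqP/(congr1 val).
  by [].
have [x|x|/z0 e|/z0 e] := iU (presub v (socle j m.+1)) (presub v Y).
- have [k [y [kj yY e]]] := dec (val x) (valP x).
  exists (Sub k (jU k kj)), (Sub y (YU y yY)); rewrite !in_presub; split=> //.
  by apply: val_inj; rewrite linearD.
- by rewrite !in_presub => xj xY; apply: val_inj; exact: dis.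
- have [k [kI kE]] := ker_embedding m.
  have [z nz] := nonzero_exists brickQ.1; case: nz; apply: kI; rewrite linear0.
  apply: hom => w; have kw : k w \in U.
    by apply: kU; rewrite in_kersub; apply/eqP/kE; exists w.
  have [x [y [xj yY ->]]] := dec _ kw.
  by rewrite (e jU x xj) add0r.
- apply: submod_anti => // x xU; have [k [y [kj yY ->]]] := dec x xU.
  by rewrite (e YU y yY) addr0.
Qed.

Lemma isom_socle m : isom (Q m) (submod (socle m m.+1)).
Proof.
rewrite -(inj_image_socle (@d_inj m)) //; exact: isom_im_full (@d_inj m).
Qed.

(** The image is some [socle j m.+2], and properness excludes [j > m.+1]. If [j < m.+1], the
    indecomposable [socle m.+1 m.+2] fits strictly in between, and two strict increases of the
    measure exceed the single [half] allowed by the hypothesis. *)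
Lemma gr_sub_socle m X (f : {linear X -> Q m.+2}) :
  injective f -> ~ (forall y, exists x, f x = y) -> indecomposable X ->
  gr_measure (Q m.+2) = gr_measure X + half (mod_length (Q m.+2)) ->
  imsub f (full_submod X) = socle m.+1 m.+2.
Proof.
move=> fI fS iX eX; set U := imsub f _.
have [fX lX bX] := inj_length fI (fQ _).
have ltX : (mod_length X < mod_length (Q m.+2))%N.
  by rewrite ltn_neqAle lX andbT; apply/eqP => /bX/bij_surj.
have [e eI] : exists e : {linear Q 1 -> X}, injective e.
  have [|/isom_sym[e be]|b] := @beyond_step m.+2 (Q m.+2) X idfun f _ fI (fQ _) iX
    ltX eX (beyond_tube m); first by [].
    by exists e; exact: bij_inj be.
  exact: beyond_embeds fI fX iX b.
have kU : {subset kersub (p m.+1) <= U}.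
  move=> y; rewrite in_kersub => /eqP py.
  have [z z0] := nonzero_exists brickQ.1.
  have [|x <-] := @brick_image _ (f \o e) y _ py; last exact: imsub_f.
  by exists z => ez; apply: z0; apply: eI; apply: fI; rewrite [LHS]ez !linear0.
have iXU := isom_im_full fI : isom X (submod U).
have [j jU] := indec_is_socle (indec_isom iXU iX) kU.
have Up := proper_not_surj fS; rewrite -/U jU in Up.
case: (ltngtP j m.+1) => jm; last by rewrite jU jm.
  have eU : gr_measure X = gr_measure (submod U).
    exact: gr_isom (submod_finite _ (fQ _)) iXU.
  pose S := socle m.+1 m.+2.
  have fS' : finite_length (submod S) := submod_finite S (fQ _).
  have iS : indecomposable (submod S) := indec_isom (isom_socle m.+1) (iQ m).
  have US : {subset U <= S} by rewrite jU; apply: socle_le; exact: ltnW.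
  have [i iE] := incl_exists US.
  have iI : injective i by move=> x y e'; apply: val_inj; rewrite -!iE e'.
  have nS : ~ (forall y, exists x, i x = y).
    move=> iS'; have [] := bij_length (inj_surj_bij iI iS') fS'.
    rewrite socle_length // jU socle_length; last by lia.
    by have := tubeQ1_gt0 tW; nia.
  have g1 := gr_lt_indec iI fS' iS nS.
  have nv : ~ (forall y, exists x : submod S, val x = y).
    move=> vS; have [] := bij_length (inj_surj_bij (@submod_val_inj _ _ S) vS) (fQ _).
    rewrite socle_length // (tubeQ_length tW m.+2).
    by have := tubeQ1_gt0 tW; nia.
  have g2 := gr_lt_indec (@submod_val_inj _ _ S) (fQ _) (iQ m.+1) nv.
  have h0 := half_gt0 (mod_length (submod S)).
  exfalso; move: g1 g2 h0; rewrite eX eU.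
  move: (gr_measure (submod U)) (gr_measure (submod S)) (half (mod_length (submod S)))
    (half _) => x y b c; lra.
by case: Up => _ []; rewrite (socle_full jm).
Qed.

End TubeSubmodules.

(** * The labelling of the tube *)

Section Labelling.
Variable A : pzRingType.

Lemma filtered_length (M N : lmodType A) t :
  finite_length M -> filtered_by M N t -> mod_length M = (t * mod_length N)%N.
Proof.
move=> fM [F [F0 Ft FS]].
suff H i : (i <= t)%N -> mod_length (submod (F i)) = (i * mod_length N)%N.
  by rewrite -H // (submod_ext Ft); have [_ ->] := isom_length (isom_full M) fM.
elim: i => [_|i IH lt].
  rewrite mul0n (submod_ext F0).
  exact/(mod_length0 (submod_finite _ fM))/zero_submodP.
have [sub [f [fS fE]]] := FS i lt.
rewrite (ker_length fS (submod_finite _ fM)) mulSn addnC; congr addn.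
rewrite -IH ?(ltnW lt) //.
have -> : F i = imsub (val : {linear submod (F i.+1) -> M}) (kersub f).
  apply: submod_anti => x; last first.
    by case/in_imsub => y; rewrite in_kersub => /eqP/fE yi <-.
  move=> xi; apply/in_imsub; exists (Sub x (sub x xi) : submod (F i.+1)) => //.
  by rewrite in_kersub; apply/eqP/fE.
have i1 := isom_imsub (kersub f) (@submod_val_inj _ _ (F i.+1)).
by have [] := isom_length i1 (submod_finite _ fM).
Qed.

(** Lengths identify the index: [M 1] has minimal length in the tube, hence that of [Q 1], and the
    filtration gives [M t] length [t] times this; the only module of the tube with that length is
    the one of index [t]. *)
Lemma tube_labelling_isom (T : lmodType A -> Prop) (W M : nat -> lmodType A) :
  tube_modules T W -> tube_labelling T M ->
  forall t, (1 <= t)%N -> isom (M t) (tubeQ W t).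
Proof.
move=> tW [TM allM _ minM filM].
have fM t : (1 <= t)%N -> finite_length (M t) by move=> /TM/(tube_vertex tW)[].
have lM t : (1 <= t)%N -> mod_length (M t) = (t * mod_length (M 1%N))%N.
  by move=> t1; apply: filtered_length; [exact: fM|exact: filM].
have inQ t : (1 <= t)%N -> exists2 s, (1 <= s)%N & isom (M t) (tubeQ W s).
  by move=> /TM/(tube_all tW)[s iM]; exists s.+1.
have q0 := tubeQ1_gt0 tW.
have eq1 : mod_length (M 1%N) = mod_length (tubeQ W 1).
  apply/eqP; rewrite eqn_leq (minM _ (tube_mem tW 0)) /=.
  have [s s1 iM] := inQ 1%N isT.
  have [_ ->] := isom_length iM (tubeQ_finite tW s).
  by rewrite (tubeQ_length tW s) leq_pmull.
move=> t t1; have [s s1 iM] := inQ t t1.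
have [_] := isom_length iM (tubeQ_finite tW s).
rewrite (lM t t1) eq1 (tubeQ_length tW s) => /eqP.
by rewrite eqn_pmul2r // => /eqP ts; rewrite -ts in iM.
Qed.

End Labelling.

Lemma brick_isom (A : pzRingType) (M N : lmodType A) :
  isom M N -> brick M -> brick N.
Proof.
move=> iMN [M0 bM]; split=> [N0|f [x fx]].
  by apply: M0; exact: isom_zero (isom_sym iMN) N0.
have [u /bij_inverse[v [uK vK]]] := iMN.
have [|g [gK Kg]] := bM (v \o f \o u).
  exists (v x) => /=; rewrite vK => e.
  by apply: fx; rewrite -[LHS]vK e linear0.
exists (u \o g \o v); split=> y /=.
  by have := gK (v y); rewrite /= vK => ->.
by apply: (can_inj vK); exact: (Kg (v y)).
Qed.

Theorem theoremB (k : comNzRingType) (A : algType k) (hA : artin_algebra A)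
    (T : lmodType A -> Prop) (hT : homogeneous_tube T)
    (M : nat -> lmodType A) (hM : tube_labelling T M)
    (m : nat) (hm : (2 <= m)%N) :
  (forall (t : nat) (F : nat -> submodClosed (M m)),
     gr_filtration t F ->
     exists i : nat, (1 <= i <= t)%N /\ isom (submod (F i)) (M 1%N))
  /\
  (brick (M 1%N) ->
   exists U : submodClosed (M m),
     (forall X : submodClosed (M m), isom (submod X) (M m.-1) <-> X =i U) /\
     (forall X : submodClosed (M m),
        gr_submodule X (full_submod (M m)) <-> X =i U)).
Proof.
have [W tW] := homogeneous_tube_modules hT.
have [p [a [d [ass dI]]]] := tube_meshes tW.
have iso := tube_labelling_isom tW hM.
case: m hm => [|[|n]] // _; rewrite [n.+2.-1]/=.
have [phi bphi] := iso n.+2 isT; have phiI := bij_inj bphi.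
have fQ := tubeQ_finite tW; have iQ := tubeQ_indec tW.
have [fM lM] := bij_length bphi (fQ n.+2).
split=> [t F /(gr_filtration_tube tW ass bphi)[i [it iF]]|bM].
  by exists i; split=> //; apply: isom_trans iF (isom_sym (iso 1%N isT)).
have bQ := brick_isom (iso 1%N isT) bM.
pose S := socle p n.+1 n.+2; pose U := presub phi S.
have imU : imsub phi U = S.
  apply: submod_anti => y.
    by case/in_imsub => x; rewrite in_presub => ? <-.
  move=> yS; have [x e] := bij_surj bphi y; rewrite -e.
  by apply: imsub_f; rewrite in_presub e.
have UE (X : submodClosed (M n.+2)) : imsub phi X = S -> X =i U.
  by move=> e x; rewrite /U -e presub_im.
have iU : isom (submod U) (tubeQ W n.+1).
  apply: isom_trans (isom_imsub U phiI) _; rewrite imU; apply: isom_sym.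
  exact (isom_socle tW ass dI bQ n.+1).
have iF : isom (submod (full_submod (M n.+2))) (tubeQ W n.+2).
  by apply: isom_trans (isom_full _) _; exists phi.
have [_ lF] := isom_length iF (fQ _); have gF := gr_isom (fQ _) iF.
have nF : ~ simple_module (submod (full_submod (M n.+2))).
  move=> /simple_length[_]; rewrite lF (tubeQ_length tW n.+2).
  by have := tubeQ1_gt0 tW; nia.
have imval (X : submodClosed (M n.+2)) :
    imsub (phi \o (val : {linear submod X -> M n.+2})) (full_submod _) = imsub phi X.
  apply: submod_anti => y /in_imsub[x xX <-].
    by apply: imsub_f; exact: valP.
  by apply/in_imsub; exists (Sub x xX : submod X).
have valI (X : submodClosed (M n.+2)) :
    injective (phi \o (val : {linear submod X -> M n.+2})).
  exact: inj_comp phiI val_inj.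
(* The measure of [U] is obtained indirectly: some Gabriel-Roiter submodule exists, and
   [gr_sub_socle] identifies its image with [S]. *)
have [X0 [f0 [f0I f0S iX0 eX0]]] : exists (X : lmodType A) (f : {linear X -> tubeQ W n.+2}),
    [/\ injective f, ~ (forall y, exists x, f x = y), indecomposable X &
        gr_measure (tubeQ W n.+2) = gr_measure X + half (mod_length (tubeQ W n.+2))].
  apply: (gr_sub_exists (fQ n.+2) (iQ n.+1)) => /simple_length[_].
  rewrite (tubeQ_length tW n.+2); have := tubeQ1_gt0 tW; nia.
have imX0 := gr_sub_socle tW ass dI bQ f0I f0S iX0 eX0.
have gU : gr_measure (submod U) = gr_measure X0.
  rewrite (gr_isom (fQ _) iU); apply/esym/gr_isom; first exact: fQ.
  apply: isom_trans (isom_im_full f0I) _; rewrite imX0; apply: isom_sym.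
  exact (isom_socle tW ass dI bQ n.+1).
exists U; split=> X; split.
(* Composing the inclusion of [X] with an isomorphism from [tubeQ W n.+1] does not change its image,
   and every embedding of [tubeQ W n.+1] has image [S]. *)
- move=> iX; have [g bg] := isom_trans iX (iso n.+1 isT).
  have [h [gK hK]] := bij_inverse bg; apply: UE; rewrite -imval.
  have := inj_image_socle tW ass dI bQ (inj_comp (valI X) (can_inj hK)
    : injective ((phi \o val) \o h)) (leqnSn _); rewrite -/S => <-.
  apply: submod_anti => y /in_imsub[x _ <-].
    by apply/in_imsub; exists (g x) => //=; rewrite gK.
  by apply/in_imsub; exists (h x).
- by move=> /submod_ext->; apply: isom_trans iU (isom_sym (iso n.+1 isT)).
- move=> [_ _ iX Xp eX]; apply: UE; rewrite -imval.
  apply: (gr_sub_socle tW ass dI bQ (valI X)) => //.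
    move=> vS; apply: (proper_val_not_surj Xp) => y.
    by have [x /phiI <-] := vS (phi y); exists x.
  by rewrite -gF -lF /half -eX addrC subrK.
move=> /submod_ext->; split=> //.
- exact: indec_isom (isom_sym iF) (iQ n.+1).
- exact: indec_isom (isom_sym iU) (iQ n).
- split=> // /sub_full_eq Ufull; have := isom_length iU (fQ _).
  rewrite Ufull => -[_]; rewrite lF (tubeQ_length tW n.+2) (tubeQ_length tW n.+1).
  by have := tubeQ1_gt0 tW; nia.
by rewrite gF gU eX0 lF addrC addKr.
Qed.
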